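(* Let $\{X_t : t\ge 0\}$ be a Cauchy process and let $$\Lambda := \{(a, X_t+at) : a,t\in[0,1]\}\subset \mathbb{R}^2 .$$ Then the union $\bigcup_{k=0}^{3} e^{i\pi k/4}\Lambda$ of four rotated copies of $\Lambda$ is almost surely an optimal Kakeya set. That is, almost surely this union is a Kakeya set and it is optimal; and there exist positive constants $c_1,c_2$ such that, almost surely, for all sufficiently small $\epsilon>0$, $$\frac{c_1}{|\log\epsilon|}\le \mathrm{vol}(\Lambda(\epsilon))\le \frac{c_2}{|\log \epsilon|}.$$
   Context: A Cauchy process $\{X_t:t\ge 0\}$ is a real-valued Lévy process (independent stationary increments, càdlàg paths, $X_0=0$) whose increments $X_{s+t}-X_s$ have the same law as $tX_1$, where $X_1$ has the Cauchy density $x\mapsto \frac{1}{\pi(1+x^2)}$. A subset $S$ of $\mathbb{R}^2$ is called a Kakeya set if for every point $P$ on the unit circle in $\mathbb{R}^2$ there is a translate of the line segment $(0,P)$ that is contained in $S$. For $A\subset\mathbb{R}^2$ and $\epsilon>0$, $A(\epsilon)=A+\mathcal{B}(0,\epsilon)$ denotes the $\epsilon$-neighbourhood of $A$, where $\mathcal{B}(0,\epsilon)$ is the open ball of radius $\epsilon$ about $0$; $\mathrm{vol}$ denotes Lebesgue measure (area) in $\mathbb{R}^2$. A Kakeya set $K$ is called optimal if $\mathrm{vol}(K(\epsilon))=O(1/|\log\epsilon|)$ as $\epsilon\to 0$. $\mathbb{R}^2$ is identified with $\mathbb{C}$, so $e^{i\pi k/4}\Lambda$ is the rotation of $\Lambda$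 about the origin by the angle $\pi k/4$. The constants $c_1,c_2$ are deterministic; the threshold below which $\epsilon$ is ''sufficiently small'' may depend on the realization of the process. *)

(* Defs.v *)
From HB Require Import structures.
From mathcomp Require Import all_boot all_order all_algebra.
From mathcomp Require Import all_classical all_reals all_analysis.

Set Implicit Arguments.
Unset Strict Implicit.
Unset Printing Implicit Defensive.

Import Order.TTheory GRing.Theory Num.Theory.
Import numFieldTopology.Exports numFieldNormedType.Exports.

Local Open Scope classical_set_scope.
Local Open Scope ring_scope.

(* The product rule over all of 'I_n gives the rule for every subfamily, by
   taking some of the A i to be setT. *)
Definition mutually_independent d (T : measurableType d) (R : realType)
    (P : probability T R) (n : nat) (Y : 'I_n -> T -> R) : Prop :=
  forall A : 'I_n -> set R, (forall i, measurable (A i)) ->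
    P (\bigcap_i (Y i @^-1` A i)) = (\prod_(i < n) P (Y i @^-1` A i))%E.

(* Tested on measurable sets only: a measure of the library is an arbitrary
   function outside of them. *)
Definition same_law d (T : measurableType d) (R : realType)
    (P : probability T R) (Y Z : T -> R) : Prop :=
  forall A : set R, measurable A -> P (Y @^-1` A) = P (Z @^-1` A).

Definition cadlag (R : realType) (f : R -> R) : Prop :=
  (forall t, 0 <= t -> f x @[x --> t^'+] --> f t) /\
  (forall t, 0 < t -> cvg (f x @[x --> t^'-])).

(* The time set is [0, +oo[; the variables X t with t < 0 are unconstrained. *)
Record levy_process d (T : measurableType d) (R : realType)
    (P : probability T R) (X : R -> {RV P >-> R}) : Prop := {
  levy_start : forall w, X 0 w = 0 ;
  levy_cadlag : forall w, cadlag (fun t => X t w) ;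
  levy_independent : forall (n : nat) (t : nat -> R),
    0 <= t 0%N -> {homo t : i j / (i <= j)%N >-> i <= j} ->
    mutually_independent P
      (fun (i : 'I_n) (w : T) => X (t i.+1) w - X (t i) w) ;
  levy_stationary : forall s t : R, 0 <= s -> 0 <= t ->
    same_law P (fun w => X (s + t) w - X s w) (X t) }.

Definition cauchy_density (R : realType) (x : R) : R :=
  1 / (pi * (1 + x ^+ 2)).

Record cauchy_process d (T : measurableType d) (R : realType)
    (P : probability T R) (X : R -> {RV P >-> R}) : Prop := {
  cauchy_levy : levy_process X ;
  cauchy_scaling : forall s t : R, 0 <= s -> 0 <= t ->
    same_law P (fun w => X (s + t) w - X s w) (fun w => t * X 1 w) ;
  cauchy_law1 : forall A : set R, measurable A ->
    P (X 1 @^-1` A) =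
    (\int[lebesgue_measure]_(x in A) (cauchy_density x)%:E)%E }.

Section plane.
Context {R : realType}.
Implicit Types (A K S : set (R * R)) (e : R).

(* The norm of the library on R * R is the sup norm. *)
Definition enorm (p : R * R) : R := Num.sqrt (p.1 ^+ 2 + p.2 ^+ 2).

Definition eball e : set (R * R) := [set p | enorm p < e].

Definition nbhd A e : set (R * R) := [set a + b | a in A & b in eball e].

Definition area : set (R * R) -> \bar R :=
  (lebesgue_measure \x lebesgue_measure)%E.

(* Segments are taken with their endpoints. *)
Definition kakeya S : Prop :=
  forall p : R * R, enorm p = 1 ->
    exists v : R * R, [set v + (s * p.1, s * p.2) | s in `[0, 1]] `<=` S.

(* [fine] sends +oo to 0, whence the finiteness clause. *)
Definition optimal_kakeya K : Prop :=
  [/\ kakeya K,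
      \forall e \near 0^'+, area (nbhd K e) \is a fin_num &
      (fun e : R => fine (area (nbhd K e)) : R^o) =O_ (0^'+)
        (fun e : R => 1 / `|ln e| : R^o)].

(* Multiplication by e^{i theta} under the identification of R^2 with C. *)
Definition rotation (theta : R) (p : R * R) : R * R :=
  (cos theta * p.1 - sin theta * p.2, sin theta * p.1 + cos theta * p.2).

Definition Lambda (f : R -> R) : set (R * R) :=
  [set (a, f t + a * t) | a in `[0, 1] & t in `[0, 1]].

End plane.

(* Main.v *)
(* By monotonicity in epsilon, and since |ln epsilon| doubles from one scale to
   the next, it is enough to bound the area of the r-neighbourhood of Lambda
   for r = 2^-p with p = 2^u.

   The lower bound holds for every path.  For each slope t, Lambda contains a
   segment of slope t over [0, 1]; two tubes of radius r with slopes t and t'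
   meet in area at most 8 r^2 / |t - t'|, and Bonferroni's inequality for about
   2^p / p equally spaced slopes gives an area of order 1/p.

   For the upper bound, cut the neighbourhood along the lines x = a, for a in a
   grid of mesh r.  On such a line one has to count the cells [c r, (c + 1) r)
   visited by Y_t = X_t + a t, sampled with mesh h = 2^-(p + v).  Time [0, 2) is
   cut into 2p blocks of n sampling times.  As P(|Y_s| < r) >= r / (20 s) for
   s >= r, each first visit of a cell is followed within n steps by at least
   g = 2^v (p - u) / 40 expected visits within distance r; since cells visited
   for the first time are distinct, a block has at most O(n / g) = O(2^p / p^2)
   expected first visits, conditionally on the past.  The same estimate after
   each first visit bounds an exponential moment of the total number of visits
   by 2^(2p), so that more than C 2^p / p cells are visited with probability at
   most 2^(-8p).  This survives the union over the grid of lines and the limit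
   h -> 0, and Borel-Cantelli concludes. *)
Require Import Defs.
From HB Require Import structures.
From mathcomp Require Import all_boot all_order all_algebra.
From mathcomp Require Import all_classical all_reals all_analysis.
From mathcomp Require Import measurable_realfun.
From mathcomp Require Import ring lra zify.
Import Order.TTheory GRing.Theory Num.Theory.
Import numFieldTopology.Exports numFieldNormedType.Exports.
Local Open Scope classical_set_scope.
Local Open Scope ring_scope.

(** * Area and rotations *)

Lemma lebesgue_measure_shift {R : realType} (A : set R) (c : R) : measurable A ->
  (lebesgue_measure ((fun y => (y + c)%R) @^-1` A) = lebesgue_measure A)%E.
Proof.
move=> mA; pose f : measurableTypeR R -> measurableTypeR R := fun y => y + c.
have mf : measurable_fun setT f.
  by apply: measurable_funD; [exact: measurable_id|exact: measurable_cst].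
apply/esym.
pose F : {mfun measurableTypeR R >-> measurableTypeR R} :=
  HB.pack f (isMeasurableFun.Build _ _ _ _ f mf).
apply: (@lebesgue_measure_unique R (pushforward lebesgue_measure F)) => //.
move=> X [[a b]] _ <-; rewrite /pushforward/= /f.
rewrite [X in _ = lebesgue_measure X](_ : _ = `]a - c, b - c]%classic); last first.
  apply/seteqP; split => y /=; rewrite !in_itv/= ltrBlDr lerBrDr //.
rewrite !lebesgue_measure_itv/= !lte_fin.
by rewrite ltrD2r; case: ifP => // _; rewrite -!EFinB; congr (_%:E); ring.
Qed.

Lemma area_shear_y {R : realType} (A : set (R * R)) (c : R) : measurable A ->
  area ((fun p => (p.1, p.2 + c * p.1)) @^-1` A) = area A.
Proof.
move=> mA; rewrite /area /product_measure1; apply: eq_integral => x _ /=.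
rewrite -(lebesgue_measure_shift (xsection A x) (c * x)); last first.
  exact: measurable_xsection.
congr lebesgue_measure; apply/seteqP; split => y /=; by rewrite /xsection/= !inE.
Qed.

(** [area] integrates the lengths of vertical sections. Uniqueness of the product measure gives the
    same with horizontal sections, whose lengths a horizontal shear preserves. *)
Lemma area_ysectionE {R : realType} (A : set (R * R)) : measurable A ->
  area A = (\int[lebesgue_measure]_y (lebesgue_measure \o ysection A) y)%E.
Proof.
move=> mA.
have := @product_measure_unique _ _ _ _ R lebesgue_measure lebesgue_measure
  (lebesgue_measure \x^ lebesgue_measure)%E.
apply => //.
by move=> B C mB mC; rewrite /= product_measure2E.
Qed.

Lemma measurable_shear_y {R : realType} (c : R) :
  measurable_fun setT (fun p : R * R => (p.1, p.2 + c * p.1)).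
Proof.
apply/measurable_fun_pairP; split => //=.
  exact: measurable_fst.
apply: measurable_funD; first exact: measurable_snd.
by apply: measurable_funM => //; exact: measurable_fst.
Qed.

Lemma measurable_shear_x {R : realType} (c : R) :
  measurable_fun setT (fun p : R * R => (p.1 + c * p.2, p.2)).
Proof.
apply/measurable_fun_pairP; split => //=; last exact: measurable_snd.
apply: measurable_funD; first exact: measurable_fst.
by apply: measurable_funM => //; exact: measurable_snd.
Qed.

Lemma area_shear_x {R : realType} (A : set (R * R)) (c : R) : measurable A ->
  area ((fun p => (p.1 + c * p.2, p.2)) @^-1` A) = area A.
Proof.
move=> mA; rewrite !area_ysectionE//; last first.
  rewrite -[_ @^-1` _]setTI; exact: (measurable_shear_x c).
apply: eq_integral => y _ /=.
rewrite -(lebesgue_measure_shift (ysection A y) (c * y)); last first.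
  exact: measurable_ysection.
congr lebesgue_measure; apply/seteqP; split => x /=; by rewrite /ysection/= !inE.
Qed.

(* A rotation is the composition of three shears. *)
Lemma area_rotation {R : realType} (A : set (R * R)) (c s : R) :
  measurable A -> s != 0 -> c ^+ 2 + s ^+ 2 = 1 ->
  area ((fun p => (c * p.1 - s * p.2, s * p.1 + c * p.2)) @^-1` A) = area A.
Proof.
(* For [c = cos theta] and [s = sin theta] this is [- tan (theta / 2)]: the outer two shears are
   horizontal with coefficient [t], the middle one is vertical with coefficient [s]. *)
move=> mA s0 cs; pose t := (c - 1) / s.
have mAx : measurable ((fun p => (p.1 + t * p.2, p.2)) @^-1` A).
  by rewrite -[_ @^-1` _]setTI; exact: measurable_shear_x.
have mAxy : measurable ((fun p => (p.1, p.2 + s * p.1)) @^-1`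
    ((fun p => (p.1 + t * p.2, p.2)) @^-1` A)).
  by rewrite -[_ @^-1` _]setTI; exact: measurable_shear_y.
rewrite -(area_shear_x A t mA) -(area_shear_y _ s mAx) -(area_shear_x _ t mAxy).
congr area; apply/funext => -[x y] /=; rewrite /preimage/=.
have st : s * t = c - 1 by rewrite /t mulrC divfK.
have tc : t * (c + 1) = - s.
  apply: (mulfI s0); rewrite mulrA st.
  by transitivity (c ^+ 2 - 1); [ring|rewrite -cs; ring].
have stc : s * t + 1 = c by rewrite st; ring.
congr (A (_, _)).
  transitivity ((s * t + 1) * x + (t * (s * t + 1 + 1)) * y); last by ring.
  by rewrite stc tc; ring.
by transitivity (s * x + (s * t + 1) * y); [rewrite stc|ring].
Qed.

(** The sigma-algebra of the plane is generated by rectangles, so an open set is written as a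
    countable union of squares with rational centres; a square not contained in [U] is replaced by
    the empty set. *)
Lemma measurable_square_open {R : realType} (U : set (R * R)) :
  (forall p, U p -> exists2 r : R, 0 < r & forall q : R * R,
     `|q.1 - p.1| < r -> `|q.2 - p.2| < r -> U q) ->
  measurable U.
Proof.
move=> Uop.
pose Q (i : rat * rat * nat) : set (R * R) :=
  [set x | `|x - ratr i.1.1| < i.2.+1%:R^-1] `*`
  [set x | `|x - ratr i.1.2| < i.2.+1%:R^-1].
pose F i := if `[< Q i `<=` U >] then Q i else set0.
have -> : U = \bigcup_i F i.
  apply/seteqP; split => [p Up|p [i _]]; last first.
    by rewrite /F; case: ifPn => // /asboolP; apply.
  have [r r0 rU] := Uop _ Up.
  (* Half of [r], since both [p] and [q] are within [d] of the rational centre. *)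
  have [n nr] : exists n, n.+1%:R^-1 < r / 2 :> R.
    have /ltr_add_invr[n] : 0 < r / 2 by rewrite divr_gt0.
    by rewrite add0r; exists n.
  set d := n.+1%:R^-1 in nr.
  have d0 : 0 < d by rewrite invr_gt0.
  have near_rat (x : R) : exists a : rat, `|x - ratr a| < d.
    have [|a] := @rat_in_itvoo R (x - d) (x + d); first by lra.
    rewrite in_itv/= => /andP[xa ax]; exists a.
    by rewrite ltr_norml; apply/andP; split; lra.
  have [a pa] := near_rat p.1; have [b pb] := near_rat p.2.
  exists ((a, b), n) => //; rewrite /F asboolT//.
  move=> q [] /=; rewrite -/d => qa qb; apply: rU.
    have -> : q.1 - p.1 = (q.1 - ratr a) - (p.1 - ratr a) by ring.
    by rewrite (le_lt_trans (ler_normB _ _))//; lra.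
  have -> : q.2 - p.2 = (q.2 - ratr b) - (p.2 - ratr b) by ring.
  by rewrite (le_lt_trans (ler_normB _ _))//; lra.
apply: countable_bigcupT_measurable; first exact: countableP.
move=> i; rewrite /F; case: ifP => // _; apply: measurableX.
  rewrite [X in measurable X](_ : _ = ball (ratr i.1.1 : R) i.2.+1%:R^-1); last first.
    by apply/funext => x; rewrite /ball/= distrC.
  exact: measurable_ball.
rewrite [X in measurable X](_ : _ = ball (ratr i.1.2 : R) i.2.+1%:R^-1); last first.
  by apply/funext => x; rewrite /ball/= distrC.
exact: measurable_ball.
Qed.

(** * Euclidean neighbourhoods and their rotations *)

Lemma enorm_ge_fst {R : realType} (p : R * R) : `|p.1| <= enorm p.
Proof.
rewrite /enorm -sqrtr_sqr ler_sqrt ?lerDl ?sqr_ge0//.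
by rewrite addr_ge0 ?sqr_ge0.
Qed.

Lemma enorm_ge_snd {R : realType} (p : R * R) : `|p.2| <= enorm p.
Proof.
rewrite /enorm -sqrtr_sqr ler_sqrt ?lerDr ?sqr_ge0//.
by rewrite addr_ge0 ?sqr_ge0.
Qed.

Lemma enorm_add_le {R : realType} (p q : R * R) :
  enorm (p + q) <= enorm p + `|q.1| + `|q.2|.
Proof.
have p1 := enorm_ge_fst p; have p2 := enorm_ge_snd p.
have N0 : 0 <= enorm p by exact: sqrtr_ge0.
have NE : enorm p ^+ 2 = p.1 ^+ 2 + p.2 ^+ 2.
  by rewrite sqr_sqrtr// addr_ge0 ?sqr_ge0.
have q1 : `|q.1| ^+ 2 = q.1 ^+ 2 by rewrite real_normK// num_real.
have q2 : `|q.2| ^+ 2 = q.2 ^+ 2 by rewrite real_normK// num_real.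
have pq1 : p.1 * q.1 <= enorm p * `|q.1|.
  by rewrite (le_trans (ler_norm _))// normrM ler_wpM2r.
have pq2 : p.2 * q.2 <= enorm p * `|q.2|.
  by rewrite (le_trans (ler_norm _))// normrM ler_wpM2r.
have q12 : 0 <= `|q.1| * `|q.2| by rewrite mulr_ge0.
rewrite {1}/enorm -[leRHS]ger0_norm ?addr_ge0// -sqrtr_sqr ler_sqrt ?sqr_ge0//=.
nra.
Qed.

Lemma nbhd_square_open {R : realType} (A : set (R * R)) (e : R) (p : R * R) :
  nbhd A e p -> exists2 r : R, 0 < r & forall q : R * R,
     `|q.1 - p.1| < r -> `|q.2 - p.2| < r -> nbhd A e q.
Proof.
move=> [a Aa [b be <-]].
exists ((e - enorm b) / 2); first by rewrite divr_gt0// subr_gt0.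
move=> q q1 q2; exists a => //; exists (b + (q - (a + b))); last first.
  by rewrite addrA addrCA subrr addr0.
rewrite /eball/= (le_lt_trans (enorm_add_le _ _))//.
by move: q1 q2 => /=; lra.
Qed.

Lemma measurable_nbhd {R : realType} (A : set (R * R)) (e : R) :
  measurable (nbhd A e).
Proof. by apply: measurable_square_open => p /nbhd_square_open. Qed.

Lemma nbhdS {R : realType} (A B : set (R * R)) (e e' : R) :
  A `<=` B -> e <= e' -> nbhd A e `<=` nbhd B e'.
Proof.
move=> AB ee' _ [a Aa [b be <-]]; exists a; first exact: AB.
by exists b => //; exact: lt_le_trans ee'.
Qed.

Lemma le_area {R : realType} (A B : set (R * R)) :
  measurable A -> measurable B -> A `<=` B -> (area A <= area B)%E.
Proof. by move=> mA mB AB; apply: le_measure => //; rewrite inE. Qed.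

(** The rotation by [- t] preserves area and maps the neighbourhood of the rotated set into
    [nbhd A e]. The condition on [sin t] comes from the decomposition into shears. *)
Lemma area_nbhd_rotation {R : realType} (A : set (R * R)) (e t : R) :
  sin t != 0 ->
  (area (nbhd (rotation t @` A) e) <= area (nbhd A e))%E.
Proof.
move=> st0; have rotB : nbhd (rotation t @` A) e `<=`
    (fun p => (cos t * p.1 - (- sin t) * p.2, - sin t * p.1 + cos t * p.2))
      @^-1` nbhd A e.
  move=> _ [_ [a Aa <-] [b be <-]]; rewrite /rotation/=.
  exists a => //.
  exists (cos t * b.1 + sin t * b.2, - sin t * b.1 + cos t * b.2).
    rewrite /eball /enorm/= [X in Num.sqrt X](_ : _ = b.1 ^+ 2 + b.2 ^+ 2)//.
    rewrite -[RHS]mul1r -(cos2Dsin2 t); ring.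
  case: a Aa => a1 a2 _ /=; congr pair.
    transitivity ((cos t ^+ 2 + sin t ^+ 2) * a1 + cos t * b.1 + sin t * b.2);
      last by ring.
    by rewrite cos2Dsin2 /=; ring.
  transitivity ((cos t ^+ 2 + sin t ^+ 2) * a2 - sin t * b.1 + cos t * b.2);
    last by ring.
  by rewrite cos2Dsin2 /=; ring.
have mB : measurable ((fun p => (cos t * p.1 - (- sin t) * p.2,
    - sin t * p.1 + cos t * p.2)) @^-1` nbhd A e).
  rewrite -[_ @^-1` _]setTI.
  suff mf : measurable_fun setT (fun p : R * R => (cos t * p.1 - (- sin t) * p.2,
    - sin t * p.1 + cos t * p.2)) by apply: mf => //; exact: measurable_nbhd.
  apply/measurable_fun_pairP; split => /=.
    by apply: measurable_funB; apply: measurable_funM.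
  by apply: measurable_funD; apply: measurable_funM.
rewrite -[leRHS](@area_rotation R _ (cos t) (- sin t)) ?oppr_eq0 ?sqrrN ?cos2Dsin2//.
  by apply: le_area => //; exact: measurable_nbhd.
exact: measurable_nbhd.
Qed.

(** * The lower bound *)

Lemma measure_big_setU_le {d} {T : measurableType d} {R : realType}
    (mu : {measure set T -> \bar R}) (I : Type) (s : seq I) (F : I -> set T) :
  (forall i, measurable (F i)) ->
  (mu (\big[setU/set0]_(i <- s) F i) <= \sum_(i <- s) mu (F i))%E.
Proof.
move=> mF; elim: s => [|i s IH]; first by rewrite !big_nil measure0.
rewrite !big_cons (le_trans (measureU2 _ _ _))//; last exact: leeD2l.
exact: bigsetU_measurable.
Qed.

(** By induction on [M]: a new set adds at least its measure minus its overlaps with the earlier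
    sets, hence at least [a - b]. *)
Lemma bonferroni_le {d} {T : measurableType d} {R : realType}
    (mu : {measure set T -> \bar R}) (A : nat -> set T) (M : nat) (a b : R) :
  (forall j, measurable (A j)) ->
  (forall j, (j < M)%N -> (a%:E <= mu (A j))%E) ->
  (forall j, (j < M)%N -> (\sum_(i < j) mu (A j `&` A i) <= b%:E)%E) ->
  ((M%:R * (a - b))%:E <= mu (\big[setU/set0]_(i < M) A i))%E.
Proof.
move=> mA; elim: M => [_ _|M IH ha hb]; first by rewrite mul0r.
have mU n : measurable (\big[setU/set0]_(i < n) A i).
  by apply: bigsetU_measurable => i _.
rewrite big_ord_recr/=; set U := \big[setU/set0]_(i < M) A i.
have -> : U `|` A M = U `|` (A M `\` U).
  apply/seteqP; split => x [Ux|]; [by left| |by left|by case; right].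
  by have [Ux|nUx] := pselect (U x); [left|right].
rewrite measureU//; [|exact: mU|by apply: measurableD => //; exact: mU|]; last first.
  by apply/seteqP; split => x // -[Ux []].
rewrite -natr1 mulrDl mul1r EFinD; apply: leeD.
  by apply: IH => j jM; [apply: ha|apply: hb]; exact: ltnW.
rewrite EFinB leeBlDr//.
apply: (le_trans (ha M (ltnSn M))).
have -> : mu (A M) = (mu (A M `\` U) + mu (A M `&` U))%E.
  by rewrite -measureDI//; exact: mU.
rewrite leeD2l//; apply: (le_trans _ (hb M (ltnSn M))).
rewrite /U big_distrr/=; apply: measure_big_setU_le => i.
exact: measurableI.
Qed.

(** Thickness is measured vertically: a strip is then a sheared rectangle, of explicit area, and
    vertical closeness implies Euclidean closeness. *)
Definition strip {R : realType} (x0 rho u t e : R) : set (R * R) :=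
  [set p | `|p.1 - x0| < rho /\ `|p.2 - (u + t * p.1)| < e].

Lemma stripE {R : realType} (x0 rho u t e : R) : strip x0 rho u t e =
  (fun p => (p.1, p.2 + (- t) * p.1)) @^-1` (ball x0 rho `*` ball u e).
Proof.
have E (x y : R) : - (u - (y + - t * x)) = y - (u + t * x) by ring.
apply/seteqP; split => -[x y] [/= xr ye]; split; rewrite /= /ball/= in xr ye *.
- by rewrite distrC.
- by rewrite -normrN E.
- by rewrite distrC.
- by rewrite -E normrN.
Qed.

Lemma measurable_strip {R : realType} (x0 rho u t e : R) :
  measurable (strip x0 rho u t e).
Proof.
rewrite stripE -[_ @^-1` _]setTI; apply: measurable_shear_y => //.
by apply: measurableX; exact: measurable_ball.
Qed.

Lemma area_strip {R : realType} (x0 rho u t e : R) : 0 <= rho -> 0 <= e ->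
  area (strip x0 rho u t e) = (4 * rho * e)%:E.
Proof.
move=> rho0 e0.
have mB : measurable (ball x0 rho `*` ball u e).
  by apply: measurableX; exact: measurable_ball.
rewrite stripE area_shear_y// /area.
transitivity (lebesgue_measure (ball x0 rho) * lebesgue_measure (ball u e))%E.
  by apply: product_measure1E; exact: measurable_ball.
rewrite !lebesgue_measure_ball// -EFinM; congr (_%:E); ring.
Qed.

Lemma strip_in_nbhd {R : realType} (f : R -> R) (t e : R) : 0 <= t <= 1 ->
  strip (2^-1) (2^-1) (f t) t e `<=` nbhd (Lambda f) e.
Proof.
move=> t01 [x y] [/=]; rewrite ltr_norml => /andP[x0 x1] ye.
exists (x, f t + x * t).
  exists x; first by rewrite /= in_itv/=; apply/andP; split; lra.
  by exists t.
exists (0, y - (f t + t * x)).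
  by rewrite /eball /enorm/= expr0n add0r sqrtr_sqr.
by congr pair => /=; ring.
Qed.

(** Over a point of the intersection the two lines differ by less than [2 * e], so its abscissa is
    within [2 * e / |t - t'|] of that of their crossing: the intersection lies in a strip of that
    half-width. *)
Lemma area_strip_setI {R : realType} (u u' t t' e : R) : t != t' -> 0 < e ->
  (area (strip (2^-1) (2^-1) u t e `&` strip (2^-1) (2^-1) u' t' e) <=
   (8 * e ^+ 2 / `|t - t'|)%:E)%E.
Proof.
move=> tt' e0; have d0 : 0 < `|t - t'| by rewrite normr_gt0 subr_eq0.
have -> : 8 * e ^+ 2 / `|t - t'| = 4 * (2 * e / `|t - t'|) * e by field; lra.
rewrite -(area_strip ((u' - u) / (t - t')) _ u t); last 2 first.
- by rewrite divr_ge0// mulr_ge0// ltW.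
- exact: ltW.
apply: le_area; [by apply: measurableI; exact: measurable_strip| |].
  exact: measurable_strip.
move=> [x y] [[/= _ y1] [/= _ y2]]; split => //=.
rewrite ltr_pdivlMr// -normrM mulrBl divfK ?subr_eq0//.
have -> : x * (t - t') - (u' - u) = (y - (u' + t' * x)) - (y - (u + t * x)).
  by ring.
by rewrite (le_lt_trans (ler_normB _ _))//; lra.
Qed.

Lemma area_big_setU_le {R : realType} (I : Type) (s : seq I) (F : I -> set (R * R)) :
  (forall i, measurable (F i)) ->
  (area (\big[setU/set0]_(i <- s) F i) <= \sum_(i <- s) area (F i))%E.
Proof.
exact: (measure_big_setU_le (@lebesgue_measure R \x @lebesgue_measure R)%E I s F).
Qed.

(** Bonferroni for the strips of slopes [j / M]: each has area [2 * e], and strips [i < j] overlap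
    in area at most [8 * e ^+ 2 * M / (j - i)], which leads to a harmonic sum. *)
Lemma area_nbhd_Lambda_ge {R : realType} (f : R -> R) (e H : R) (M : nat) :
  0 < e -> (0 < M)%N ->
  (forall j, (j < M)%N -> \sum_(i < j) i.+1%:R^-1 <= H :> R) ->
  ((M%:R * (2 * e - 8 * e ^+ 2 * M%:R * H))%:E <= area (nbhd (Lambda f) e))%E.
Proof.
move=> e0 M0 HH; have M0R : 0 < M%:R :> R by rewrite ltr0n.
pose t j : R := j%:R / M%:R.
pose A j := strip (2^-1) (2^-1) (f (t j)) (t j) e.
have mA j : measurable (A j) by exact: measurable_strip.
apply: (@le_trans _ _ (area (\big[setU/set0]_(i < M) A i))); last first.
  apply: le_area; [exact: bigsetU_measurable|exact: measurable_nbhd|].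
  rewrite -bigcup_mkord => p [j /= jM]; apply: strip_in_nbhd.
  by rewrite /t divr_ge0//= ler_pdivrMr// mul1r ler_nat ltnW.
apply: bonferroni_le => // j jM.
  by rewrite [leRHS]area_strip ?invr_ge0//; [rewrite lee_fin; lra|exact: ltW].
apply: (@le_trans _ _ (\sum_(i < j) (8 * e ^+ 2 * M%:R * (j - i)%:R^-1)%:E)%E).
  apply: lee_sum => i _.
  have ij : 0 < (j - i)%:R :> R by rewrite ltr0n subn_gt0.
  have tE : t j - t i = (j - i)%:R / M%:R.
    by rewrite natrB ?mulrBl// ltnW.
  have tij : 0 < t j - t i by rewrite tE divr_gt0.
  apply: (le_trans (area_strip_setI _ _ _ _ _ _ e0)).
    by rewrite -subr_eq0 gt_eqF.
  by rewrite gtr0_norm// tE lee_fin invf_div mulrA.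
rewrite sumEFin lee_fin -mulr_sumr ler_wpM2l//.
  by rewrite !mulr_ge0// ?sqr_ge0// ltW.
apply: le_trans (HH _ jM); rewrite (reindex_inj rev_ord_inj)/=.
by apply: ler_sum => i _; rewrite subKn.
Qed.

(** Doubling the range of indices adds at most 1. *)
Lemma harmonic_dyadic_le {R : realType} (w j : nat) : (j <= 2 ^ w)%N ->
  \sum_(i < j) i.+1%:R^-1 <= w.+1%:R :> R.
Proof.
move=> jw; apply: (@le_trans _ _ (\sum_(i < 2 ^ w) i.+1%:R^-1)).
  rewrite -!(big_mkord xpredT (fun i => i.+1%:R^-1)).
  rewrite [leRHS](big_cat_nat (n := j))//= lerDl sumr_ge0// => i _.
elim: w {jw} => [|w IH]; first by rewrite big_ord_recr big_ord0/= add0r invr1.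
rewrite -(big_mkord xpredT (fun i => i.+1%:R^-1)).
rewrite (big_cat_nat (n := 2 ^ w)%N) ?leq_pexp2l//= big_mkord -natr1 lerD//.
apply: (@le_trans _ _ (\sum_(2 ^ w <= i < 2 ^ w.+1) (2 ^ w)%:R^-1)).
  apply: ler_sum_nat => i /andP[wi _].
  by rewrite lef_pV2 ?posrE ?ltr0n ?expn_gt0// ler_nat ltnW.
rewrite big_const_nat iter_addr addr0 expnS mul2n -addnn addnK.
by rewrite -[_ *+ _]mulr_natr mulVf// pnatr_eq0 expn_eq0.
Qed.

(** * Covering Lambda by boxes *)

Lemma measure_bigcup_nondecreasing_le {d} {T : measurableType d} {R : realType}
    (mu : {measure set T -> \bar R}) (F : nat -> set T) (c : \bar R) :
  (forall n, measurable (F n)) -> (forall n, F n `<=` F n.+1) ->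
  (forall n, (mu (F n) <= c)%E) -> (mu (\bigcup_n F n) <= c)%E.
Proof.
move=> mF ndF Fc.
have nd : nondecreasing_seq F by apply/nondecreasing_seqP => n; apply/subsetPset.
have cv := nondecreasing_cvg_mu mF (bigcupT_measurable F mF) nd (mu := mu).
rewrite -(cvg_lim _ cv)//; apply: lime_le; first by apply/cvg_ex; eexists; exact: cv.
exact: nearW.
Qed.

Lemma half_pow_lt {R : realType} (e : R) : 0 < e ->
  exists n, (2 ^ n)%:R^-1 < e.
Proof.
move=> e0; have /ltr_add_invr[n] : 0 < e by [].
rewrite add0r => ne; exists n; apply: le_lt_trans ne.
by rewrite lef_pV2 ?posrE ?ltr0n ?expn_gt0// ler_nat ltn_expl.
Qed.

(** The index of the interval [[c * r, (c + 1) * r)] in which the segment of slope [s] meets the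
    vertical line of abscissa [a]. *)
Definition cell {R : realType} (r : R) (f : R -> R) (a s : R) : int :=
  Num.floor ((f s + a * s) / r).

Lemma cell_near {R : realType} (r : R) (f : R -> R) (a s : R) : 0 < r ->
  `|f s + a * s - (cell r f a s)%:~R * r| <= r.
Proof.
move=> r0; set y := f s + a * s.
have /andP[] := floor_itv ((y / r)).
rewrite /cell -/y => fl1 fl2.
have l1 : (Num.floor (y / r))%:~R * r <= y by rewrite -ler_pdivlMr.
have l2 : y < (Num.floor (y / r) + 1)%:~R * r by rewrite -ltr_pdivrMr.
rewrite intrD mulrDl mul1r in l2.
by rewrite ler_norml; apply/andP; split; lra.
Qed.

Section cover.
Context {R : realType} (f : R -> R) (p : nat).
Let r : R := (2 ^ p)%:R^-1.
Let h (v : nat) : R := (2 ^ (p + v))%:R^-1.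
(** The grid starts at [- r] because the neighbourhood extends beyond [[0, 1]] by up to [r]; the
    columns with [l < 2 ^ p + 2] cover [[- r, 1 + r)]. *)
Let a (l : nat) : R := (l%:R - 1) * r.

(** The sampling times run over [[0, 2)]: a time in [[0, 1]] is approximated from the right,
    possibly beyond 1. *)
Definition dyadic_cells (v l : nat) : seq int :=
  [seq cell r f (a l) (k%:R * h v) | k <- iota 0 (2 ^ (p + v).+1)].

Let box l (c : int) := strip (a l) r (c%:~R * r) 0 (6 * r).
Let W v l := \big[setU/set0]_(c <- undup (dyadic_cells v l)) box l c.
Let U v := \big[setU/set0]_(l < 2 ^ p + 2) W v l.

Let r0 : 0 < r. Proof. by rewrite invr_gt0 ltr0n expn_gt0. Qed.
Let h0 v : 0 < h v. Proof. by rewrite invr_gt0 ltr0n expn_gt0. Qed.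
Let r1 : r <= 1.
Proof. by rewrite invf_le1 ?ltr0n ?expn_gt0// ler1n expn_gt0. Qed.

Lemma dyadic_cellsS v l : {subset dyadic_cells v l <= dyadic_cells v.+1 l}.
Proof.
move=> c /mapP[k]; rewrite mem_iota add0n => /= kv ->.
apply/mapP; exists (2 * k)%N.
  by rewrite mem_iota add0n/= addnS [in ltnRHS]expnS ltn_mul2l.
congr (cell _ _ _ _); rewrite /h addnS expnS natrM; field.
by rewrite pnatr_eq0 expn_eq0.
Qed.

Let UP v x : U v x <-> exists l c, [/\ (l < 2 ^ p + 2)%N, c \in dyadic_cells v l
  & box l c x].
Proof.
rewrite /U -bigcup_mkord; split.
  move=> [l /= lp]; rewrite /W -bigcup_seq => -[c /=].
  by rewrite mem_undup => cD bx; exists l, c.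
move=> [l [c [lp cD bx]]]; exists l => //.
by rewrite /W -bigcup_seq; exists c => //=; rewrite mem_undup.
Qed.

Hypothesis cf : cadlag f.

(** For a point coming from time [t], right continuity gives a grid time [s] after [t] with [f s]
    close to [f t]. The mesh depends on the point, whence the union over [v]. *)
Let cover : nbhd (Lambda f) r `<=` \bigcup_v U v.
Proof.
move=> _ [_ [b b01 [t t01 <-]] [q qe <-]].
rewrite /= !in_itv/= in b01 t01; move: t01 b01 => /andP[t0 t1] /andP[b0 b1].
have q1 : `|q.1| < r by rewrite (le_lt_trans (enorm_ge_fst _)).
have q2 : `|q.2| < r by rewrite (le_lt_trans (enorm_ge_snd _)).
have [v [s [fs ts [k ks sk]]]] : exists v s, [/\ `|f s - f t| < r / 2,
    0 <= s - t <= r / 2 & exists2 k, (k < 2 ^ (p + v).+1)%N & s = k%:R * h v].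
  have r20 : 0 < r / 2 by rewrite divr_gt0.
  have /cvgrPdist_lt/(_ _ r20) := cf.1 t t0 => -[/= d d0 near_t].
  have [v vd] : exists n, (2 ^ n)%:R^-1 < Num.min d (r / 2).
    by apply: half_pow_lt; rewrite lt_min d0.
  have : h v < Num.min d (r / 2).
    apply: le_lt_trans vd; rewrite lef_pV2 ?posrE ?ltr0n ?expn_gt0// ler_nat.
    by rewrite leq_pexp2l// leq_addl.
  rewrite lt_min => /andP[hd hr].
  have th0 : 0 <= t / h v by rewrite divr_ge0// ltW.
  have /andP[k1 k2] := truncn_itv th0.
  rewrite ler_pdivlMr// in k1; rewrite ltr_pdivrMr// in k2.
  set k := Num.truncn (t / h v) in k1 k2.
  have kS : k.+1%:R * h v = k%:R * h v + h v by rewrite -natr1 mulrDl mul1r.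
  exists v, (k.+1%:R * h v); split.
  - rewrite distrC; apply: near_t => //=.
    by rewrite ltr_norml; apply/andP; split; lra.
  - by apply/andP; split; lra.
  - exists k.+1 => //; rewrite -(ltr_nat R) expnS natrM -ltr_pdivrMr ?ltr0n ?expn_gt0//.
    rewrite -[X in _ * X]/(h v) kS; apply: (@le_lt_trans _ _ (1 + r / 2)).
      by rewrite lerD//; [exact: le_trans k1 t1|exact: ltW].
    by move: r1; lra.
have x0 : 0 <= (b + q.1) / r + 1.
  rewrite -[1](@divff _ r) ?gt_eqF// -mulrDl divr_ge0//; last exact: ltW.
  by move: q1; rewrite ltr_norml => /andP[? ?]; lra.
have /andP[l1 l2] := truncn_itv x0.
set l := Num.truncn _ in l1 l2.
exists v => //; apply/UP; exists l, (cell r f (a l) s); split.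
- rewrite -(ltr_nat R); apply: (le_lt_trans l1); rewrite natrD.
  have : (b + q.1) / r < (1 + r) / r.
    by rewrite ltr_pM2r ?invr_gt0//; move: q1; rewrite ltr_norml => /andP[? ?]; lra.
  rewrite [X in _ < X]mulrDl divff ?gt_eqF// mul1r /r invrK; lra.
- by apply/mapP; exists k => //; rewrite ?mem_iota ?sk.
have al1 : a l <= b + q.1.
  by rewrite /a -ler_pdivlMr//; lra.
have al2 : b + q.1 < a l + r.
  by rewrite /a mulrBl mul1r subrK -ltr_pdivrMr//; move: l2; rewrite -natr1; lra.
have := cell_near r f (a l) s r0; set c := _%:~R * r => cr.
split => /=; first by rewrite ltr_norml; apply/andP; split; lra.
rewrite mul0r addr0.
move: q1 q2 fs ts; rewrite !ltr_norml => /andP[q11 q12] /andP[q21 q22].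
move=> /andP[fs1 fs2] /andP[ts1 ts2].
move: cr; rewrite ler_norml => /andP[cr1 cr2].
have r0' := r0; have r1' := r1.
have al4 : a l <= 2 by lra.
have al5 : - 2 <= a l by lra.
have als1 : a l * (s - t) <= r.
  have : a l * (s - t) <= 2 * (s - t) by apply: ler_wpM2r => //; lra.
  lra.
have als2 : - r <= a l * (s - t).
  have : - 2 * (s - t) <= a l * (s - t) by apply: ler_wpM2r => //; lra.
  lra.
have tal1 : t * (a l - b) <= 2 * r.
  have : t * (a l - b) <= t * (2 * r) by apply: ler_wpM2l => //; lra.
  have : t * (2 * r) <= 1 * (2 * r) by apply: ler_wpM2r => //; lra.
  lra.
have tal2 : - (2 * r) <= t * (a l - b).
  have : t * (b - a l) <= t * (2 * r) by apply: ler_wpM2l => //; lra.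
  have : t * (2 * r) <= 1 * (2 * r) by apply: ler_wpM2r => //; lra.
  lra.
have alE : a l * s - b * t = a l * (s - t) + t * (a l - b) by ring.
(* The errors are [r] for [q.2], [r / 2] for the path, [r] for [a l * (s - t)], [2 * r] for
   [t * (a l - b)] and [r] for the cell: less than [6 * r] in all. *)
rewrite -/c; by apply/andP; split; lra.
Qed.

(** [U v] consists of at most [(2 ^ p + 2) * K] boxes of area [24 * r ^+ 2] and grows with [v], so
    continuity from below preserves the bound. *)
Lemma area_nbhd_Lambda_le (K : nat) :
  (forall v l, (l < 2 ^ p + 2)%N -> (size (undup (dyadic_cells v l)) <= K)%N) ->
  (area (nbhd (Lambda f) r) <= ((2 ^ p + 2)%:R * K%:R * (24 * r ^+ 2))%:E)%E.
Proof.
move=> DK; have mb l c : measurable (box l c) by exact: measurable_strip.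
have mU v : measurable (U v).
  by apply: bigsetU_measurable => l _; apply: bigsetU_measurable => c _.
apply: (@le_trans _ _ (area (\bigcup_v U v))).
  by apply: le_area => //; [exact: measurable_nbhd|exact: bigcupT_measurable].
apply: measure_bigcup_nondecreasing_le => // v.
  move=> x /UP[l [c [lp cD bx]]]; apply/UP; exists l, c; split => //.
  exact: dyadic_cellsS.
have mW l : measurable (W v l) by apply: bigsetU_measurable => c _.
apply: le_trans.
  apply: (area_big_setU_le _ _ (fun l : 'I_(2 ^ p + 2) => W v l)) => l.
  exact: mW.
apply: (@le_trans _ _ (\sum_(l < 2 ^ p + 2) (K%:R * (24 * r ^+ 2))%:E)%E); last first.
  by rewrite sumEFin sumr_const card_ord -mulrA lee_fin [leRHS]mulr_natl.
apply: lee_sum => l _.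
apply: le_trans; first exact: area_big_setU_le.
have r60 : 0 <= 6 * r by rewrite mulr_ge0// ltW.
rewrite (eq_bigr (fun=> (24 * r ^+ 2)%:E)); last first.
  by move=> c _; rewrite [LHS]area_strip//; [congr (_%:E); ring|exact: ltW].
rewrite sumEFin big_const_seq count_predT iter_addr addr0 lee_fin.
rewrite -[leLHS]mulr_natl; apply: ler_wpM2r; last by rewrite ler_nat DK.
by rewrite mulr_ge0 ?sqr_ge0.
Qed.

End cover.

(** * The Kakeya property *)

(** The slope [q.2 / q.1] lies in [[0, 1]], so [Lambda f] contains a segment of this slope over
    [[0, 1]]; its part over [[0, q.1]] is a translate of the segment from 0 to [q]. *)
Lemma rotation_segment {R : realType} (f : R -> R) (t : R) (q : R * R) :
  enorm q = 1 -> 0 <= q.2 <= q.1 ->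
  exists v : R * R, [set v + (s * (rotation t q).1, s * (rotation t q).2)
    | s in `[0, 1]] `<=` rotation t @` Lambda f.
Proof.
case: q => c s /= q1 /andP[s0 sc].
have qE : c ^+ 2 + s ^+ 2 = 1.
  by rewrite -[LHS]sqr_sqrtr ?addr_ge0 ?sqr_ge0// -/(enorm (c, s)) q1 expr1n.
have c0 : 0 < c.
  rewrite lt_neqAle (le_trans s0)// andbT; apply/eqP => c0; move: qE sc.
  rewrite -c0 => qE sc; have s00 : s = 0 by apply/eqP; rewrite eq_le s0 sc.
  by move: qE; rewrite s00 expr0n/= addr0 => /eqP; rewrite eq_sym oner_eq0.
have c1 : c <= 1 by nra.
pose m := s / c.
have m01 : 0 <= m <= 1.
  by rewrite /m divr_ge0//=; [rewrite ler_pdivrMr// mul1r|exact: ltW].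
exists (rotation t (0, f m)) => _ [z /= z01 <-].
rewrite in_itv/= in z01; move: z01 => /andP[z0 z1].
exists (z * c, f m + z * c * m).
  exists (z * c); first by rewrite /= in_itv/= mulr_ge0//=; [nra|exact: ltW].
  by exists m => //; rewrite /= in_itv.
have -> : z * c * m = z * s by rewrite /m; field; rewrite gt_eqF.
by rewrite /rotation; congr pair => /=; ring.
Qed.

Lemma sqr_cos_pi4 {R : realType} : cos (pi / 4) ^+ 2 = 2^-1 :> R.
Proof.
have : cos (pi / 4 + pi / 4) = 0 :> R.
  by rewrite -cos_pihalf; congr cos; field.
rewrite cosD -!expr2 => /subr0_eq cs.
by have := cos2Dsin2 (pi / 4 : R); rewrite -cs; lra.
Qed.

Lemma sin_pi4 {R : realType} : sin (pi / 4) = cos (pi / 4) :> R.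
Proof.
by rewrite -cosBpihalf -cosN; congr cos; lra.
Qed.

Lemma cos_pi4_gt0 {R : realType} : 0 < cos (pi / 4) :> R.
Proof. by apply: cos_gt0_pihalf; have := @pi_gt0 R; lra. Qed.

(** The upper half plane splits into four sectors of angle [pi / 4]; each witness [q] is [p] rotated
    back by [pi * k / 4]. *)
Lemma rotation_sector {R : realType} (p : R * R) : enorm p = 1 -> 0 <= p.2 ->
  exists (k : nat) (q : R * R), [/\ (k < 4)%N, enorm q = 1, 0 <= q.2 <= q.1 &
    p = rotation (pi * k%:R / 4) q].
Proof.
case: p => x y /= p1 y0.
set k0 : R := cos (pi / 4).
have kk : k0 * k0 = 2^-1 by rewrite -expr2 sqr_cos_pi4.
have kp : 0 < k0 := cos_pi4_gt0.
have k0E : k0 ^+ 2 * 2 = 1 by rewrite expr2 kk; lra.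
have e1 (u v : R) : u ^+ 2 + v ^+ 2 = x ^+ 2 + y ^+ 2 -> enorm (u, v) = 1.
  by rewrite -p1 /enorm/= => ->.
have [x0|x0] := leP 0 x.
  have [yx|xy] := leP y x.
    exists 0%N, (x, y); split => //=; first by rewrite y0.
    by rewrite /rotation mulr0 mul0r cos0 sin0/=; congr pair; ring.
  exists 1%N, (k0 * (x + y), k0 * (y - x)); split => //=.
  - by apply: e1; transitivity (k0 ^+ 2 * 2 * (x ^+ 2 + y ^+ 2));
      [ring|rewrite k0E mul1r].
  - by apply/andP; split; nra.
  - rewrite /rotation mulr1 sin_pi4 -/k0/=; congr pair.
      by transitivity (k0 ^+ 2 * 2 * x); [rewrite k0E mul1r|ring].
    by transitivity (k0 ^+ 2 * 2 * y); [rewrite k0E mul1r|ring].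
have [yx|xy] := leP (- x) y.
  exists 2%N, (y, - x); split => //=.
  - by apply: e1; ring.
  - by apply/andP; split; lra.
  - have -> : pi * 2%:R / 4 = pi / 2 :> R by field.
    by rewrite /rotation cos_pihalf sin_pihalf/=; congr pair; ring.
exists 3%N, (k0 * (y - x), - k0 * (x + y)); split => //=.
- by apply: e1; transitivity (k0 ^+ 2 * 2 * (x ^+ 2 + y ^+ 2));
    [ring|rewrite k0E mul1r].
- by apply/andP; split; nra.
- have -> : pi * 3%:R / 4 = pi / 4 + pi / 2 :> R by field.
  rewrite /rotation cosDpihalf sinDpihalf sin_pi4 -/k0/=; congr pair.
    by transitivity (k0 ^+ 2 * 2 * x); [rewrite k0E mul1r|ring].
  by transitivity (k0 ^+ 2 * 2 * y); [rewrite k0E mul1r|ring].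
Qed.

Lemma kakeya_rotations {R : realType} (f : R -> R) :
  kakeya (\bigcup_(k in `I_4) (rotation (pi * k%:R / 4) @` Lambda f)).
Proof.
move=> p p1.
have upper q : enorm q = 1 -> 0 <= q.2 -> exists v : R * R,
    [set v + (s * q.1, s * q.2) | s in `[0, 1]] `<=`
    \bigcup_(k in `I_4) (rotation (pi * k%:R / 4) @` Lambda f).
  move=> q1 q2; have [k [z [k4 z1 z2 ->]]] := rotation_sector q q1 q2.
  have [v vL] := rotation_segment f (pi * k%:R / 4) z z1 z2.
  by exists v => x /vL; exists k.
have [p2|p2] := leP 0 p.2; first exact: upper.
have Np1 : enorm (- p) = 1 by rewrite -p1 /enorm/= !sqrrN.
have [|v vL] := upper (- p) Np1; first by rewrite /= oppr_ge0 ltW.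
(* For a direction in the lower half plane, the segment found for [- p] is traversed backwards from
   its endpoint [v - p]. *)
exists (v - p) => _ [s /= s01 <-]; rewrite in_itv/= in s01.
apply: (vL); exists (1 - s); first by rewrite /= in_itv/=; lra.
case: v {vL} => v1 v2; case: p {p1 p2 Np1} => x y.
by congr pair => /=; ring.
Qed.

(** * Counting and integration *)

(** The pointwise count is integrated: the sum of the indicators is at most [N] times that of
    [A]. *)
Lemma sum_measure_le_count {d} {T : measurableType d} {R : realType}
    (mu : {measure set T -> \bar R}) (I : Type) (s : seq I) (B : I -> set T)
    (A : set T) (N : nat) : measurable A ->
  (forall i, measurable (B i)) -> (forall i, B i `<=` A) ->
  (forall w, (\sum_(i <- s) (w \in B i) <= N)%N) ->
  (\sum_(i <- s) mu (B i) <= N%:R%:E * mu A)%E.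
Proof.
move=> mA mB BA BN.
have -> : (\sum_(i <- s) mu (B i) =
    \int[mu]_w (\sum_(i <- s) (\1_(B i) w)%:E))%E.
  rewrite ge0_integral_sum//.
  - by apply: eq_bigr => i _; rewrite integral_indic// setIT.
  - by move=> i; apply/measurable_EFinP; exact: measurable_indic.
have -> : (N%:R%:E * mu A = \int[mu]_w (N%:R%:E * (\1_A w)%:E))%E.
  rewrite ge0_integralZl//.
  - by rewrite integral_indic// setIT.
  - by apply/measurable_EFinP; exact: measurable_indic.
apply: ge0_le_integral => //.
- by move=> w _; apply: sume_ge0 => i _; rewrite lee_fin.
- by apply: emeasurable_sum => i; apply/measurable_EFinP; exact: measurable_indic.
- by apply: measurable_funeM; apply/measurable_EFinP; exact: measurable_indic.
move=> w _; rewrite sumEFin -EFinM lee_fin indicE.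
under eq_bigr do rewrite indicE.
rewrite -natr_sum -natrM ler_nat.
have [wA|wA] := boolP (w \in A); first by rewrite muln1.
rewrite muln0 leqn0 big1// => i _; apply/eqP; rewrite eqb0.
by apply: contra wA; rewrite !inE; exact: BA.
Qed.

Lemma count_first_visit (T : eqType) (c : nat -> T) (z : T) (m : nat) :
  (\sum_(j < m) ((c j \notin [seq c i | i <- iota 0 j]) && (c j == z)) <= 1)%N.
Proof.
elim: m => [|m IH]; first by rewrite big_ord0.
rewrite big_ord_recr/=; have [cmz|cmz] := eqVneq (c m) z; last first.
  by rewrite andbF addn0.
have [cm|cm] := boolP (c m \in _); first by rewrite addn0.
rewrite big1// => j _; apply/eqP; rewrite eqb0 negb_and orbC; apply/orP; left.
apply: contra cm => /eqP cjz; rewrite cmz -cjz; apply: map_f.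
by rewrite mem_iota /=.
Qed.

(** With [k = j + l], a counted [j] is the first visit of [c k - 1], [c k] or [c k + 1]; so each of
    the [m + n] times [k] has at most three partners [j]. *)
Lemma count_first_visit_near (c : nat -> int) (m n : nat) :
  (\sum_(j < m) \sum_(l < n) ((c j \notin [seq c i | i <- iota 0 j]) &&
     (`|c (j + l)%N - c j| <= 1)%R) <= 3 * (m + n))%N.
Proof.
pose f j k : nat := (c j \notin [seq c i | i <- iota 0 j]) && (`|c k - c j| <= 1).
apply: (@leq_trans (\sum_(j < m) \sum_(k < m + n) f j k)%N).
  apply: leq_sum => j _.
  rewrite -(big_mkord xpredT (fun l => f j (j + l)%N)).
  rewrite -(big_mkord xpredT (fun k => f j k)).
  have jm : (j + n <= m + n)%N by rewrite leq_add2r ltnW.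
  rewrite [leqRHS](@big_cat_nat _ _ _ (j + n)%N)//=.
  rewrite (@big_cat_nat _ _ _ j 0 (j + n)%N)//=; last first.
    exact: leq_addr.
  rewrite (_ : \sum_(j <= i < j + n) f j i = \sum_(0 <= l < n) f j (j + l))%N.
    by rewrite -addnA addnCA leq_addr.
  rewrite -[in LHS](add0n j) big_addn addKn; apply: eq_bigr => l _.
  by rewrite add0n addnC.
rewrite exchange_big/= mulnC -[X in (_ <= X * _)%N]card_ord -sum_nat_const.
apply: leq_sum => k _.
pose v z j : nat := (c j \notin [seq c i | i <- iota 0 j]) && (c j == z).
apply: (@leq_trans (\sum_(j < m) (v (c k - 1)%R j + v (c k) j + v (c k + 1)%R j))%N).
  apply: leq_sum => j _; rewrite /f /v; case: (_ \notin _) => //=.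
  case: (boolP (`|c k - c j| <= 1)) => //= ckj.
  have [->|[->|->]] : c j = c k - 1 \/ c j = c k \/ c j = c k + 1 by lia.
  - by rewrite eqxx.
  - by rewrite eqxx; case: (_ == _).
  - by rewrite eqxx addn1.
rewrite !big_split/= -[3%N]/(1 + 1 + 1)%N.
by rewrite !leq_add// /v count_first_visit.
Qed.

Lemma floor_near {R : realType} (x y : R) : `|x - y| < 1 ->
  `|Num.floor x - Num.floor y| <= 1.
Proof.
have /andP[x1 x2] := floor_itv x; have /andP[y1 y2] := floor_itv y.
rewrite ltr_norml => /andP[xy1 xy2].
rewrite intrD in x2; rewrite intrD in y2.
have : Num.floor x - Num.floor y < 2.
  by rewrite -(ltr_int R) intrB; lra.
have : Num.floor y - Num.floor x < 2.
  by rewrite -(ltr_int R) intrB; lra.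
lia.
Qed.

(** The tail products from [j] and from [j + 1] differ by [L * x j] times the latter; these
    differences telescope. *)
Lemma prod_telescope {R : comNzRingType} (L : R) (x : nat -> R) (n : nat) :
  \prod_(k < n) (1 + L * x k) =
  1 + L * \sum_(j < n) x j * \prod_(k < n - j.+1) (1 + L * x (j.+1 + k)%N).
Proof.
elim: n x => [|n IH] x; first by rewrite !big_ord0 mulr0 addr0.
pose Q := \prod_(k < n) (1 + L * x k.+1).
pose S := \sum_(j < n) x j.+1 * \prod_(k < n - j.+1) (1 + L * x (j.+1 + k).+1).
have -> : \prod_(k < n.+1) (1 + L * x k) = (1 + L * x 0%N) * Q.
  by rewrite big_ord_recl.
have -> : \sum_(j < n.+1) x j * \prod_(k < n.+1 - j.+1) (1 + L * x (j.+1 + k)%N) =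
    x 0%N * Q + S.
  rewrite big_ord_recl; congr (_ + _).
  by rewrite /= subSS subn0; congr (_ * _).
have -> : Q = 1 + L * S by exact: (IH (fun k => x k.+1)).
ring.
Qed.

Lemma ge0_integral_le_split {d} {T : measurableType d} {R : realType}
    (mu : {measure set T -> \bar R}) (A : set T) (n : nat) (F : nat -> set T)
    (f V : T -> R) (W : nat -> T -> R) (L : R) :
  measurable A -> (forall j, measurable (F j)) ->
  measurable_fun setT f -> measurable_fun setT V ->
  (forall j, measurable_fun setT (W j)) -> 0 <= L ->
  (forall w, 0 <= f w) -> (forall w, 0 <= V w) -> (forall j w, 0 <= W j w) ->
  (forall w, f w <= V w + L * \sum_(j < n) \1_(F j) w * W j w) ->
  (\int[mu]_(w in A) (f w)%:E <= \int[mu]_(w in A) (V w)%:E +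
   L%:E * \sum_(j < n) \int[mu]_(w in A `&` F j) (W j w)%:E)%E.
Proof.
move=> mA mF mf mV mW L0 f0 V0 W0 fVW.
have mFW j : measurable_fun A (fun w => (\1_(F j) w * W j w)%:E).
  apply: measurable_funTS; apply/measurable_EFinP; apply: measurable_funM => //.
have FW0 j w : (0 <= (\1_(F j) w * W j w)%:E)%E by rewrite lee_fin mulr_ge0.
have -> : (\sum_(j < n) \int[mu]_(w in A `&` F j) (W j w)%:E =
    \int[mu]_(w in A) \sum_(j < n) (\1_(F j) w * W j w)%:E)%E.
  rewrite (ge0_integral_sum _ mA (fun j : 'I_n => mFW j)) //.
  apply: eq_bigr => j _; rewrite integral_mkcondr.
  apply: eq_integral => w _; rewrite patchE indicE.
  by case: (w \in F j); rewrite ?mul1r ?mul0r.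
have mS : measurable_fun A (fun w => (\sum_(j < n) (\1_(F j) w * W j w)%:E)%E).
  by apply: emeasurable_sum => j; exact: mFW.
have mVA : measurable_fun A (EFin \o V).
  by apply: measurable_funTS; exact/measurable_EFinP.
rewrite -ge0_integralZl_EFin//; last first.
  by move=> w _; apply: sume_ge0 => j _; exact: FW0.
rewrite -ge0_integralD//; last 3 first.
- by move=> w _; rewrite lee_fin.
- move=> w _; apply: mule_ge0; rewrite ?lee_fin//.
  by apply: sume_ge0 => j _; exact: FW0.
- exact: measurable_funeM.
apply: ge0_le_integral => //.
- by move=> w _; rewrite lee_fin.
- by apply: measurable_funTS; exact/measurable_EFinP.
- by apply: emeasurable_funD => //; exact: measurable_funeM.
by move=> w _; rewrite sumEFin -EFinM -EFinD lee_fin.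
Qed.

Lemma size_undup_first_visits (T : eqType) (c : nat -> T) (N : nat) :
  size (undup [seq c k | k <- iota 0 N]) =
  (\sum_(k < N) (c k \notin [seq c i | i <- iota 0 k]))%N.
Proof.
elim: N => [|N IH]; first by rewrite big_ord0.
rewrite big_ord_recr -IH.
have -> : iota 0 N.+1 = rcons (iota 0 N) N by rewrite -addn1 iotaD cats1.
rewrite map_rcons undup_rcons size_rcons size_filter.
set s := [seq c k | k <- iota 0 N].
have := count_predC (pred1 (c N)) (undup s).
rewrite count_uniq_mem ?undup_uniq// mem_undup => <-.
by case: (_ \in _); rewrite /= ?addn1 ?add1n ?addn0.
Qed.

(** Bernoulli's inequality with exponent [b]. *)
Lemma two_le_expr {R : realFieldType} (b : nat) : (0 < b)%N ->
  2 <= (1 + b%:R^-1) ^+ b :> R.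
Proof.
move=> b0; have bR : 0 < b%:R :> R by rewrite ltr0n.
suff : forall k : nat, 1 + k%:R * b%:R^-1 <= (1 + b%:R^-1) ^+ k :> R.
  by move=> /(_ b); rewrite divff ?gt_eqF//; apply: le_trans; lra.
have bV : 0 < b%:R^-1 :> R by rewrite invr_gt0.
elim=> [|k IH]; first by rewrite mul0r addr0 expr0.
rewrite exprS; apply: le_trans (ler_wpM2l _ IH); last by rewrite addr_ge0// ltW.
have kb : 0 <= k%:R * b%:R^-1 * b%:R^-1 :> R.
  by rewrite !mulr_ge0// ltW.
rewrite -natr1; lra.
Qed.

Lemma markov_set {d} {T : measurableType d} {R : realType}
    (P : probability T R) (f : T -> R) (c m : R) : 0 < c ->
  measurable_fun setT f -> (forall w, 0 <= f w) ->
  (\int[P]_(w in setT) (f w)%:E <= m%:E)%E ->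
  measurable [set w | c <= f w] /\ (P [set w | (c <= f w)%R] <= (m / c)%:E)%E.
Proof.
move=> c0 mf f0 fm.
have mB : measurable [set w | c <= f w].
  rewrite (_ : [set w | _] = setT `&` f @^-1` `[c, +oo[%classic).
    by apply: mf => //; exact: measurable_itv.
  by rewrite setTI; apply/seteqP; split => w /=; rewrite in_itv/= andbT.
split=> //.
have : (c%:E * P [set w | (c <= f w)%R] <= m%:E)%E.
  apply: le_trans fm; rewrite -integral_cst//.
  apply: (@le_trans _ _ (\int[P]_(w in [set w | (c <= f w)%R]) (f w)%:E)%E).
    apply: ge0_le_integral => //.
    - by move=> w _; rewrite lee_fin ltW.
    - by apply: measurable_funTS; exact/measurable_EFinP.
  apply: ge0_subset_integral => //.
  - exact/measurable_EFinP.
  - by move=> w _; rewrite lee_fin.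
set B := [set w | _] in mB *.
have -> : P B = (fine (P B))%:E by rewrite fineK// fin_num_measure.
by rewrite -EFinM !lee_fin ler_pdivlMr// mulrC.
Qed.

(** Each of the [k] dyadic ranges contributes at least [1 / 2]. *)
Lemma harmonic_dyadic_ge {R : realType} (v k : nat) :
  k%:R / 2 <= \sum_(2 ^ v <= l < 2 ^ (v + k)) l%:R^-1 :> R.
Proof.
elim: k => [|k IH]; first by rewrite mul0r addn0 big_geq.
rewrite addnS (big_cat_nat (n := 2 ^ (v + k))%N) ?leq_pexp2l ?leq_addr//=.
rewrite -natr1 mulrDl lerD// mul1r.
have -> : 2^-1 = \sum_(2 ^ (v + k) <= l < 2 ^ (v + k).+1) (2 ^ (v + k).+1)%:R^-1 :> R.
  rewrite big_const_nat iter_addr addr0 expnS mul2n -addnn addnK natrD.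
  rewrite -[RHS]mulr_natr; have : (2 ^ (v + k))%:R != 0 :> R.
    by rewrite pnatr_eq0 expn_eq0.
  by move=> N0; field.
apply: ler_sum_nat => l /andP[l1 l2].
rewrite lef_pV2 ?posrE ?ltr0n ?expn_gt0//; last by rewrite (leq_trans _ l1)// expn_gt0.
by rewrite ler_nat ltnW.
Qed.

Lemma measurable_cauchy_density {R : realType} :
  measurable_fun setT (@cauchy_density R).
Proof.
apply: continuous_measurable_fun => x; rewrite /cauchy_density.
have p0 : pi * (1 + x ^+ 2) != 0 :> R.
  by rewrite gt_eqF// mulr_gt0 ?pi_gt0// ltr_pwDl// sqr_ge0.
apply: cvgM; first exact: cvg_cst.
apply: cvgV => //; apply: cvgM; first exact: cvg_cst.
apply: cvgD; first exact: cvg_cst.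
exact: exprn_continuous.
Qed.

(** The ball lies in [[-3, 3]], where the density is at least [1 / (10 * pi) >= 1 / 40], and has
    length [2 * e]. *)
Lemma cauchy_law1_ball_ge {R : realType} {d : measure_display} {T : measurableType d}
    {P : probability T R} (X : R -> {RV P >-> R}) (hX : cauchy_process X) (c e : R) :
  `|c| <= 2 -> 0 <= e <= 1 -> ((e / 20)%:E <= P (X 1%R @^-1` ball c e))%E.
Proof.
move=> c2 /andP[e0 e1]; rewrite (cauchy_law1 hX); last exact: measurable_ball.
apply: (@le_trans _ _ (\int[lebesgue_measure]_(x in ball c e) (40^-1 : R)%:E)%E).
  rewrite integral_cst; last exact: measurable_ball.
  rewrite [X in (_ * X)%E](_ : _ = (e *+ 2)%:E); last exact: lebesgue_measure_ball.
  by rewrite -EFinM lee_fin -mulr_natr; lra.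
have mb : measurable (ball c e : set R) := measurable_ball c e.
have d0 x : (0 <= (cauchy_density x)%:E)%E.
  by rewrite lee_fin /cauchy_density divr_ge0// mulr_ge0 ?pi_ge0// addr_ge0// sqr_ge0.
apply: ge0_le_integral => //.
- by apply: measurable_funTS; apply/measurable_EFinP; exact: measurable_cauchy_density.
move=> x; rewrite /ball/= => cx; rewrite lee_fin /cauchy_density mul1r.
have x3 : `|x| <= 3.
  have -> : x = c - (c - x) by ring.
  by rewrite (le_trans (ler_normB _ _))//; lra.
have x9 : x ^+ 2 <= 9.
  rewrite -real_normK ?num_real//.
  have := normr_ge0 x; nra.
have p4 : pi <= 4 :> R by have := @pihalf_lt2 R; lra.
have p0 := @pi_gt0 R.
rewrite lef_pV2 ?posrE//; first by have := sqr_ge0 x; nra.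
by rewrite mulr_gt0// ltr_pwDl// sqr_ge0.
Qed.

(** * Cells visited by the sampled process *)

Section walk.
Context {R : realType} {d : measure_display} {T : measurableType d}
  {P : probability T R} (X : R -> {RV P >-> R}) (hX : cauchy_process X)
  (h : R) (h0 : 0 < h).

Definition gap (j k : nat) (w : T) : R := X (k%:R * h) w - X (j%:R * h) w.

Notation increment i := (gap i i.+1).

(* Rectangles form a pi-system, so that independence, which is assumed for
   rectangles only, extends to the sigma-algebra they generate. *)
Definition past_rect (j : nat) : set (set T) :=
  [set A | exists2 B : nat -> set R, (forall i, measurable (B i)) &
     A = \bigcap_(i in `I_j) (increment i @^-1` B i)].

Definition past (j : nat) : set (set T) := <<s past_rect j >>.

Lemma measurable_gap j k : measurable_fun setT (gap j k).
Proof. by apply: measurable_funB. Qed.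

Lemma past_rect_setI j : setI_closed (past_rect j).
Proof.
move=> _ _ [B mB ->] [C mC ->]; exists (fun i => B i `&` C i).
  by move=> i; exact: measurableI.
by rewrite -bigcapI.
Qed.

Lemma past_rect_measurable j A : past_rect j A -> measurable A.
Proof.
move=> [B mB ->]; apply: bigcap_measurableType => i _.
by rewrite -[_ @^-1` _]setTI; apply: measurable_gap.
Qed.

Lemma past_measurable j A : past j A -> measurable A.
Proof.
move: A; apply: smallest_sub; first exact: sigma_algebra_measurable.
exact: past_rect_measurable.
Qed.

Lemma past_sub i j : (i <= j)%N -> past i `<=` past j.
Proof.
move=> ij; apply: sub_sigma_algebra2 => _ [B mB ->].
exists (fun k => if (k < i)%N then B k else setT).
  by move=> k; case: ifP.
apply/seteqP; split => w wB k /= kj.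
  by case: ifPn => // ki; exact: wB.
by have := wB k (leq_trans kj ij); rewrite /= kj.
Qed.

Lemma past_rect_indep j k A C : (j <= k)%N -> past_rect j A -> measurable C ->
  P (A `&` gap j k @^-1` C) =
  (P A * P (gap j k @^-1` C))%E.
Proof.
move=> jk [B mB ->] mC.
(* After index [j] the times jump to [k * h] and stay there, so the first [j + 1] increments along
   [t] are those of [past_rect j] followed by [gap j k]. *)
pose t i := (if (i <= j)%N then i else k)%:R * h.
have t0 : 0 <= t 0%N by rewrite /t mul0r.
have tm : {homo t : i l / (i <= l)%N >-> i <= l}.
  move=> i l il; rewrite /t ler_wpM2r//; first exact: ltW.
  rewrite ler_nat; case: ifPn => ij; case: ifPn => lj //; first exact: leq_trans jk.
  by move: ij; rewrite (leq_trans il lj).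
have ind : mutually_independent P
    (fun (i : 'I_j.+1) w => X (t i.+1) w - X (t i) w).
  exact: (levy_independent (cauchy_levy hX) t0 tm).
have tE i : (i < j)%N -> (fun w => X (t i.+1) w - X (t i) w) = increment i.
  by move=> ij; rewrite /t ij ltnW.
have tj : (fun w => X (t j.+1) w - X (t j) w) =
    gap j k.
  by rewrite /t ltnn leqnn.
have mD (D : set R) : measurable D -> P ((\bigcap_(i in `I_j)
      (increment i @^-1` B i)) `&`
      gap j k @^-1` D) =
    (\prod_(i < j) P (increment i @^-1` B i) *
      P (gap j k @^-1` D))%E.
  move=> mD; pose E i := if (i < j)%N then B i else D.
  have mE i : measurable (E i) by rewrite /E; case: ifP.
  have := ind (fun i => E i) (fun i => mE i).
  rewrite big_ord_recr/= tj /E ltnn => indE.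
  transitivity (P (\bigcap_i ((fun w => X (t (nat_of_ord i).+1) w - X (t i) w)
      @^-1` (if (nat_of_ord (i : 'I_j.+1) < j)%N then B i else D)))).
    congr (P _); apply/seteqP; split => w.
      move=> [wB wD] i _ /=; case: ifPn => ij.
        by have := wB _ ij; rewrite -(tE _ ij).
      have -> : nat_of_ord i = j.
        by apply/eqP; rewrite eqn_leq -ltnS ltn_ord leqNgt ij.
      by rewrite -[_ - _]/((fun w => X (t j.+1) w - X (t j) w) w) tj.
    move=> wE; split => [i /= ij|].
      have := wE (widen_ord (leqnSn j) (Ordinal ij)) I; rewrite /= ij.
      by rewrite -(tE _ ij).
    have := wE ord_max I; rewrite /= ltnn.
    by rewrite -[_ - _]/((fun w => X (t j.+1) w - X (t j) w) w) tj.
  rewrite indE; congr (_ * _)%E; apply: eq_bigr => i _.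
  by rewrite ltn_ord (tE _ (ltn_ord i)).
rewrite mD//; congr (_ * _)%E.
(* With [setT] as last event, the product becomes the probability of the rectangle. *)
have := mD setT measurableT.
by rewrite preimage_setT setIT probability_setT mule1.
Qed.

(** Dynkin's lemma: the events satisfying the product formula form a Dynkin system containing the
    pi-system of rectangles. *)
Lemma past_indep j k A C : (j <= k)%N -> past j A -> measurable C ->
  P (A `&` gap j k @^-1` C) =
  (P A * P (gap j k @^-1` C))%E.
Proof.
move=> jk pA mC; set B := _ @^-1` C.
have mB : measurable B.
  rewrite -[B]setTI.
  exact: measurable_gap.
suff /(_ A pA)[] : forall A, past j A ->
    measurable A /\ P (A `&` B) = (P A * P B)%E by [].
apply: (@dynkin_induction _ (g_sigma_algebraType (past_rect j)) (past_rect j)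
  (fun A : set T => measurable A /\ P (A `&` B) = (P A * P B)%E)) => //.
- exact: past_rect_setI.
- by split; [exact: measurableT|rewrite setTI probability_setT mul1e].
- move=> S rS; split; first exact: past_rect_measurable rS.
  exact: past_rect_indep.
- move=> S _ [mS SB]; split; first exact: measurableC.
  have BS : P (B `&` (S : set T)) = (P S * P B)%E by rewrite setIC.
  transitivity (P (B `\` (S : set T))); first by congr (P _); rewrite setIC.
  transitivity (P B - P (B `&` (S : set T)))%E.
    by apply: measureD => //; rewrite ltey_eq fin_num_measure.
  rewrite BS probability_setC// muleBl ?fin_num_measure ?mul1e//.
- move=> F _ tF FB; have mF n : measurable (F n : set T) := (FB n).1.
  split; first exact: bigcupT_measurable.
  rewrite setI_bigcupl measure_bigcup//=; last 2 first.
  + by move=> n _; exact: measurableI.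
  + exact: trivIset_setIr.
  rewrite measure_bigcup//= muleC -[P B]fineK ?fin_num_measure// -nneseriesZl//.
  apply: eq_eseriesr => n _; rewrite fineK ?fin_num_measure//.
  by rewrite muleC; exact: (FB n).2.
Qed.

Lemma gap_law j k C : (j <= k)%N -> measurable C ->
  P (gap j k @^-1` C) = P ((fun w => (k - j)%:R * h * X 1 w) @^-1` C).
Proof.
move=> jk mC.
have := cauchy_scaling hX (s := j%:R * h) (t := (k - j)%:R * h).
rewrite -mulrDl -natrD subnKC//; apply => //; by rewrite mulr_ge0// ltW.
Qed.

Lemma past_measurable_gap i j : (i < j)%N ->
  measurable_fun (setT : set (g_sigma_algebraType (past_rect j))) (gap i i.+1).
Proof.
move=> ij _ C mC; rewrite setTI; apply: sub_sigma_algebra.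
exists (fun l => if l == i then C else setT); first by move=> l; case: ifP.
apply/seteqP; split => w wC.
  by move=> l /= lj; case: eqP => [->|//].
by have := wC i ij; rewrite /= eqxx.
Qed.

Lemma past_measurable_position i j : (i <= j)%N ->
  measurable_fun (setT : set (g_sigma_algebraType (past_rect j)))
    (fun w => X (i%:R * h) w).
Proof.
elim: i => [_|i IH ij].
  rewrite mul0r (_ : (fun _ => _) = cst 0); first exact: measurable_cst.
  by apply/funext => w; rewrite (levy_start (cauchy_levy hX)).
rewrite (_ : (fun _ => _) = (fun w => X (i%:R * h) w) \+ gap i i.+1); last first.
  by apply/funext => w; rewrite /= /gap addrC subrK.
by apply: measurable_funD; [apply: IH; exact: ltnW|exact: past_measurable_gap].
Qed.

Variables (a r : R) (r0 : 0 < r).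

Definition walk_cell (i : nat) (w : T) : int := cell r (fun t => X t w) a (i%:R * h).

(** Visits before [s] are ignored, so that the count can restart at [s] regardless of the earlier
    path. *)
Definition fresh (s k : nat) : set T :=
  [set w | forall i, (s <= i < k)%N -> walk_cell i w <> walk_cell k w].

Lemma past_walk_cell i j (c : int) : (i <= j)%N ->
  past j [set w | walk_cell i w = c].
Proof.
move=> ij.
pose I := `[c%:~R * r, (c + 1)%:~R * r[%classic.
have mI : measurable I by exact: measurable_itv.
have mf : measurable_fun (setT : set (g_sigma_algebraType (past_rect j)))
    (fun w => X (i%:R * h) w + a * (i%:R * h)).
  by apply: measurable_funD => //; exact: past_measurable_position.
have := mf measurableT I mI; rewrite setTI.
suff -> : [set w | walk_cell i w = c] =
    (fun w => X (i%:R * h) w + a * (i%:R * h)) @^-1` I by [].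
apply/seteqP; split => w; rewrite /walk_cell /cell /I /= in_itv/=.
  move=> <-; rewrite -ler_pdivlMr// -ltr_pdivrMr//; exact: floor_itv.
by rewrite -ler_pdivlMr// -ltr_pdivrMr// => /floor_def.
Qed.

Lemma past_fresh s k j : (k <= j)%N -> past j (fresh s k).
Proof.
move=> kj.
suff : measurable (fresh s k : set (g_sigma_algebraType (past_rect j))) by [].
rewrite (_ : fresh s k = \bigcap_(i in [set i | (s <= i < k)%N])
    ~` \bigcup_(c : int) ([set w | walk_cell i w = c] `&`
        [set w | walk_cell k w = c])); last first.
  apply/seteqP; split => w wf i /= ik.
    by move=> [c _ [ic kc]]; apply: (wf i ik); rewrite ic kc.
  by move=> e; apply: (wf i ik); exists (walk_cell k w).
apply: bigcap_measurableType => i /= /andP[si ik].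
apply: measurableC; apply: countable_bigcupT_measurable; first exact: countableP.
move=> c; apply: measurableI; apply: past_walk_cell => //.
exact: (leq_trans (ltnW ik)).
Qed.

(** By [gap_law], the probability that [X t + a * t] moves by less than [r] in [l] steps, from any
    sampling time. *)
Definition hit_prob (l : nat) : \bar R :=
  P ((fun w => l%:R * h * X 1 w) @^-1` [set x | `|x + a * (l%:R * h)| < r]).

Let near0 (l : nat) : set R := [set x | `|x + a * (l%:R * h)| < r].

Let measurable_near0 l : measurable (near0 l).
Proof.
rewrite [near0 l](_ : _ = ball (- (a * (l%:R * h))) r); first exact: measurable_ball.
by apply/funext => x; rewrite /near0 /ball/= -normrN opprD opprK addrC opprK.
Qed.

Let walk_cell_near j l w : near0 l (gap j (j + l) w) ->
  `|walk_cell (j + l) w - walk_cell j w| <= 1.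
Proof.
rewrite /near0/= => wr; apply: floor_near.
rewrite -mulrBl normrM [`|r^-1|]gtr0_norm ?invr_gt0// ltr_pdivrMr// mul1r.
suff <- : gap j (j + l) w + a * (l%:R * h) = X ((j + l)%:R * h) w +
  a * ((j + l)%:R * h) - (X (j%:R * h) w + a * (j%:R * h)) by [].
by rewrite /gap natrD; ring.
Qed.

(* Pathwise, each time k is within distance r of the walk at no more than three
   fresh times: their cells are distinct and adjacent to the cell at time k.
   The event of being fresh at time j is independent of the increments after j. *)
Lemma fresh_sum_le s m n A : past s A ->
  ((\sum_(j < m) P (A `&` fresh s (s + j))) * (\sum_(l < n) hit_prob l) <=
   (3 * (m + n))%:R%:E * P A)%E.
Proof.
move=> pA; have mA := past_measurable _ _ pA.
pose B (i : 'I_m * 'I_n) := A `&` fresh s (s + i.1) `&`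
  (gap (s + i.1) (s + i.1 + i.2) @^-1` near0 i.2).
have mfr k : measurable (fresh s k) := past_measurable _ _ (past_fresh s k k (leqnn k)).
have mB i : measurable (B i).
  apply: measurableI; first exact: measurableI.
  by rewrite -[_ @^-1` _]setTI; apply: measurable_gap.
have -> : ((\sum_(j < m) P (A `&` fresh s (s + j))) * (\sum_(l < n) hit_prob l) =
    \sum_(i : 'I_m * 'I_n) P (B i))%E.
  rewrite ge0_sume_distrl// -(pair_bigA _ (fun j l => P (B (j, l))))/=.
  apply: eq_bigr => j _; rewrite ge0_sume_distrr//; apply: eq_bigr => l _.
  rewrite /B/= past_indep ?leq_addr//; last first.
    apply: (@measurableI _ (g_sigma_algebraType (past_rect (s + j)))).
      by apply: (past_sub s) pA; exact: leq_addr.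
    exact: past_fresh.
  by rewrite gap_law ?leq_addr// addKn.
apply: (sum_measure_le_count _ _ _ _ _ _ mA mB) => [i w [[]]//|w].
rewrite -(pair_bigA _ (fun (j : 'I_m) (l : 'I_n) => (w \in A `&` fresh s (s + j) `&`
  (gap (s + j) (s + j + l) @^-1` near0 l)) : nat))/=.
apply: leq_trans (count_first_visit_near (fun j => walk_cell (s + j) w) m n).
apply: leq_sum => j _; apply: leq_sum => l _.
case: (boolP (w \in _)) => //=; rewrite inE => -[[_ wf] wn].
rewrite lt0b addnA walk_cell_near// andbT.
apply/mapP => -[i]; rewrite mem_iota/= add0n => ij /esym.
by apply: wf; rewrite leq_addr ltn_add2l.
Qed.

(** Division by [l * h] turns the event into [X 1] lying within [r / (l * h) <= 1] of [- a]. *)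
Lemma hit_prob_ge l : `|a| <= 2 -> (0 < l)%N -> r <= l%:R * h ->
  ((r / (l%:R * h) / 20)%:E <= hit_prob l)%E.
Proof.
move=> a2 l0 rl; have lh0 : 0 < l%:R * h by rewrite mulr_gt0// ltr0n.
rewrite /hit_prob (_ : _ @^-1` _ = X 1 @^-1` ball (- a) (r / (l%:R * h))).
  apply: cauchy_law1_ball_ge => //; first by rewrite normrN.
  by apply/andP; split; [rewrite divr_ge0//; exact: ltW|rewrite ler_pdivrMr// mul1r].
apply/funext => w; rewrite /preimage /ball/= ltr_pdivlMr//; congr (is_true (_ < _)).
by rewrite -[in RHS](gtr0_norm lh0) -normrM -[RHS]normrN; congr `|_|; ring.
Qed.

(** * An exponential moment of the number of visited cells *)

Variables (n b : nat) (g : R).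
Hypotheses (b0 : (0 < b)%N) (g0 : 0 < g) (nbg : 12 * n%:R <= b%:R * g)
  (gn : (g%:E <= \sum_(l < n) hit_prob l)%E).

Let measurable_fresh s k : measurable (fresh s k).
Proof. exact: past_measurable (past_fresh s k k (leqnn k)). Qed.

(** As [m <= n], [fresh_sum_le] bounds [g] times the sum by [6 * n * P A], hence by
    [b * g / 2 * P A]; this is where the factor 12 in the hypothesis on [n] comes from. *)
Lemma fresh_sum_half s m A : (m <= n)%N -> past s A ->
  (\sum_(j < m) P (A `&` fresh s (s + j)) <= (b%:R / 2)%:E * P A)%E.
Proof.
move=> mn pA; have mA := past_measurable _ _ pA.
have mF j : measurable (A `&` fresh s (s + j)) by exact: measurableI.
have fS : (\sum_(j < m) P (A `&` fresh s (s + j)))%E =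
    (\sum_(j < m) fine (P (A `&` fresh s (s + j))))%:E.
  by rewrite -sumEFin; apply: eq_bigr => j _; rewrite fineK// fin_num_measure.
have S0 : 0 <= \sum_(j < m) fine (P (A `&` fresh s (s + j))).
  by apply: sumr_ge0 => j _; exact: fine_ge0.
have PA : P A = (fine (P A))%:E by rewrite fineK// fin_num_measure.
have PA0 : 0 <= fine (P A) by exact: fine_ge0.
have := fresh_sum_le s m n A pA.
rewrite fS PA => le1.
have := le_trans (lee_wpmul2l _ gn) le1; rewrite lee_fin => /(_ S0).
rewrite -!EFinM !lee_fin => le2.
set S := \sum_(j < m) _ in S0 le2 *.
have mn3 : (3 * (m + n))%:R <= 6 * n%:R :> R.
  by rewrite -natrM ler_nat; lia.
rewrite -(ler_pM2r g0); apply: (le_trans le2).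
apply: (le_trans (ler_wpM2r PA0 mn3)).
have := ler_wpM2r PA0 nbg; lra.
Qed.

(* [weight s m w] is (1 + 1/b)^N, where N counts the fresh times in [s, s + m). *)
Definition weight (s m : nat) (w : T) : R :=
  \prod_(k < m) (1 + b%:R^-1 * \1_(fresh s (s + k)) w).

(** The [m] blocks have length [n] and start at time [e]; each forgets the visits made before its
    own start. *)
Fixpoint block_weight (m e : nat) (w : T) : R :=
  if m is m'.+1 then weight e n w * block_weight m' (e + n) w else 1.

Let bV0 : 0 <= b%:R^-1 :> R. Proof. by rewrite invr_ge0. Qed.

Let factor_ge1 s k w : 1 <= 1 + b%:R^-1 * \1_(fresh s k) w :> R.
Proof. by rewrite lerDl mulr_ge0. Qed.

Lemma weight_ge1 s m w : 1 <= weight s m w.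
Proof.
rewrite /weight; elim: m => [|m IH]; first by rewrite big_ord0.
by rewrite big_ord_recr/= mulr_ege1.
Qed.

Lemma block_weight_ge1 m e w : 1 <= block_weight m e w.
Proof.
by elim: m e => [//|m IH] e /=; rewrite mulr_ege1// weight_ge1.
Qed.

Lemma measurable_weight s m : measurable_fun setT (weight s m).
Proof.
apply: measurable_prod => k _; apply: measurable_funD => //.
by apply: measurable_funM => //; exact: measurable_indic.
Qed.

Lemma measurable_block_weight m e : measurable_fun setT (block_weight m e).
Proof.
elim: m e => [|m IH] e /=; first exact: measurable_cst.
by apply: measurable_funM => //; exact: measurable_weight.
Qed.

Let le_fresh_indic s s' k w : (s <= s')%N -> \1_(fresh s k) w <= \1_(fresh s' k) w :> R.
Proof.
move=> ss'; rewrite !indicE ler_nat.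
case: (boolP (w \in fresh s k)) => // wf.
suff -> : w \in fresh s' k by [].
move: wf; rewrite !inE => wf i /andP[s'i ik]; apply: wf.
by rewrite (leq_trans ss')//.
Qed.

(** The product is expanded by [prod_telescope]; in each tail, forgetting the visits before time
    [s + j + 1] only creates more fresh times. *)
Lemma weight_le s m w : weight s m w <=
  1 + b%:R^-1 * \sum_(j < m) \1_(fresh s (s + j)) w * weight (s + j.+1) (m - j.+1) w.
Proof.
rewrite {1}/weight (prod_telescope _ (fun k => \1_(fresh s (s + k)) w)).
rewrite lerD2l ler_wpM2l//; apply: ler_sum => j _; rewrite ler_wpM2l//.
apply: ler_prod => k _; rewrite (le_trans _ (factor_ge1 _ _ _))//=.
by rewrite addnA lerD2l ler_wpM2l// le_fresh_indic// leq_addr.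
Qed.

(* After a fresh time j the remaining weight of the block is at most the weight
   of a block that restarts at j + 1, to which the induction hypothesis applies
   on an event of the past of j + 1. *)
Lemma weight_step (V : T -> R) (c : R) (e : nat) : 0 <= c ->
  measurable_fun setT V -> (forall w, 0 <= V w) ->
  (forall A, past e A -> \int[P]_(w in A) (V w)%:E <= c%:E * P A)%E ->
  forall m s A, (s + m)%N = e -> (m <= n)%N -> past s A ->
  (\int[P]_(w in A) (weight s m w * V w)%:E <= (2 * c)%:E * P A)%E.
Proof.
move=> c0 mV V0 Vc; elim/ltn_ind => m IH s A sme mn pA.
have mA := past_measurable _ _ pA.
have pow0 s' m' w : 0 <= weight s' m' w by apply: le_trans (weight_ge1 _ _ _).
apply: (@le_trans _ _ (\int[P]_(w in A) (V w)%:E + (b%:R^-1)%:E *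
    \sum_(j < m) \int[P]_(w in A `&` fresh s (s + j))
       (weight (s + j.+1) (m - j.+1) w * V w)%:E)%E).
  apply: (ge0_integral_le_split P A m (fun j => fresh s (s + j))
    (fun w => weight s m w * V w) V
    (fun j w => weight (s + j.+1) (m - j.+1) w * V w)) => //.
  - by apply: measurable_funM => //; exact: measurable_weight.
  - by move=> j; apply: measurable_funM => //; exact: measurable_weight.
  - by move=> w; rewrite mulr_ge0.
  - by move=> j w; rewrite mulr_ge0.
  move=> w; under eq_bigr do rewrite mulrA.
  rewrite -mulr_suml mulrA -[X in X + _]mul1r -mulrDl ler_wpM2r//.
  exact: weight_le.
have pAF (j : 'I_m) : past (s + j.+1) (A `&` fresh s (s + j)).
  apply: (@measurableI _ (g_sigma_algebraType (past_rect (s + j.+1)))).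
    by apply: (past_sub s) pA; exact: leq_addr.
  by apply: past_fresh; rewrite leq_add2l.
apply: (@le_trans _ _ (c%:E * P A + (b%:R^-1)%:E *
    \sum_(j < m) ((2 * c)%:E * P (A `&` fresh s (s + j))))%E).
  apply: leeD; first by apply: Vc; apply: (past_sub s) pA; rewrite -sme leq_addr.
  apply: lee_wpmul2l; first by rewrite lee_fin.
  apply: lee_sum => j _; apply: IH => //.
  - by rewrite ltn_subrL /= (leq_ltn_trans _ (ltn_ord j)).
  - by rewrite -addnA subnKC.
  - exact: leq_trans (leq_subr _ _) mn.
(* The induction closes because [c + (1 / b) * (2 * c) * (b / 2) = 2 * c]. *)
rewrite -ge0_sume_distrr//.
apply: (@le_trans _ _ (c%:E * P A + (b%:R^-1)%:E *
    ((2 * c)%:E * ((b%:R / 2)%:E * P A)))%E).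
  rewrite leeD2l// lee_wpmul2l ?lee_fin// lee_wpmul2l ?lee_fin ?mulr_ge0//.
  exact: fresh_sum_half.
rewrite -[P A]fineK ?fin_num_measure// -!EFinM -EFinD lee_fin.
have bn0 : b%:R != 0 :> R by rewrite pnatr_eq0 -lt0n.
by rewrite le_eqVlt; apply/orP; left; apply/eqP; field.
Qed.

(** Each block costs a factor 2, by [weight_step] with the weight of the later blocks as [V]. *)
Lemma block_weight_integral m e A : past e A ->
  (\int[P]_(w in A) (block_weight m e w)%:E <= (2 ^+ m)%:E * P A)%E.
Proof.
elim: m e A => [|m IH] e A pA.
  by rewrite /= integral_cst ?expr0//; exact: past_measurable pA.
rewrite exprS; apply: (weight_step _ _ (e + n)) => //.
- exact: measurable_block_weight.
- by move=> w; apply: le_trans (block_weight_ge1 _ _ _).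
- by move=> B pB; exact: IH.
Qed.

Let prod_fresh_le m e w :
  \prod_(k < m * n) (1 + b%:R^-1 * \1_(fresh 0 (e + k)) w) <= block_weight m e w.
Proof.
elim: m e => [|m IH] e; first by rewrite mul0n big_ord0.
rewrite mulSn -(big_mkord xpredT (fun k => 1 + b%:R^-1 * \1_(fresh 0 (e + k)) w)).
rewrite (big_cat_nat (n := n)) ?leq_addr//= !big_mkord.
have prod_ge0 (I : finType) (F : I -> nat) :
    0 <= \prod_(i : I) (1 + b%:R^-1 * \1_(fresh 0 (F i)) w) :> R.
  by apply: prodr_ge0 => i _; rewrite (le_trans _ (factor_ge1 _ _ _)).
apply: ler_pM => //.
- by rewrite big_seq prodr_ge0// => i _; rewrite (le_trans _ (factor_ge1 _ _ _)).
- apply: ler_prod => k _; rewrite (le_trans _ (factor_ge1 _ _ _))//=.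
  by rewrite lerD2l ler_wpM2l// le_fresh_indic.
apply: le_trans (IH (e + n)%N).
rewrite -{1}(add0n n) big_addn addKn big_mkord.
rewrite le_eqVlt; apply/orP; left; apply/eqP; apply: eq_bigr => k _.
by rewrite -addnA [(n + k)%N]addnC.
Qed.

(** Markov's inequality at level [2 ^ (5 * m)] against the moment [2 ^ m]: visiting [5 * m * b]
    cells forces a weight of at least [(1 + 1 / b) ^ (5 * m * b) >= 2 ^ (5 * m)]. *)
Lemma visited_cells_tail m : exists B : set T, [/\ measurable B,
  (P B <= ((2 ^+ (4 * m))^-1)%:E)%E &
  forall w, (5 * m * b <= size (undup [seq walk_cell k w | k <- iota 0 (m * n)]))%N ->
    B w].
Proof.
exists [set w | 2 ^+ (5 * m) <= block_weight m 0 w].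
have [||||mB PB] := markov_set P (block_weight m 0) (2 ^+ (5 * m)) (2 ^+ m).
- by rewrite exprn_gt0.
- exact: measurable_block_weight.
- by move=> w; apply: le_trans (block_weight_ge1 _ _ _).
- have := block_weight_integral m 0 setT (@measurableT _
    (g_sigma_algebraType (past_rect 0))).
  by rewrite probability_setT mule1.
split=> //.
  apply: (le_trans PB); rewrite lee_fin.
  have -> : (5 * m = m + 4 * m)%N by lia.
  by rewrite exprD invfM mulrA divff ?mul1r// expf_eq0 pnatr_eq0 andbF.
move=> w D /=; apply: le_trans (prod_fresh_le m 0 w).
have -> : \prod_(k < m * n) (1 + b%:R^-1 * \1_(fresh 0 (0 + k)) w) =
    (1 + b%:R^-1) ^+ size (undup [seq walk_cell k w | k <- iota 0 (m * n)]) :> R.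
  rewrite size_undup_first_visits.
  rewrite expr_sum.
  apply: eq_bigr => k _; rewrite add0n indicE.
  have -> : (w \in fresh 0 k) =
      (walk_cell k w \notin [seq walk_cell i w | i <- iota 0 k]).
    apply/idP/idP; rewrite ?inE.
      move=> wf; apply/mapP => -[i]; rewrite mem_iota/= add0n => ik /esym.
      exact: wf.
    move=> /mapP wn i /= ik e; apply: wn.
    by exists i => //; rewrite mem_iota.
  by case: (_ \notin _); rewrite ?mulr1 ?expr1 ?mulr0 ?addr0 ?expr0.
apply: (@le_trans _ _ ((1 + b%:R^-1) ^+ (5 * m * b))).
  rewrite [X in _ <= _ ^+ X]mulnC [leRHS]exprM.
  by apply: lerXn2r; rewrite ?nnegrE ?exprn_ge0 ?two_le_expr ?addr_ge0.
by rewrite ler_weXn2l// lerDl.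
Qed.

End walk.

(** * The upper bound *)

(** Ensures that the natural subtraction [2 ^ u - 2 * u] in [cell_bound] does not truncate. *)
Lemma double_le_expn (u : nat) : (0 < u)%N -> (2 * u <= 2 ^ u)%N.
Proof.
elim: u => [//|[//|u] IH] _; rewrite expnS.
have := IH isT; lia.
Qed.

Section dyadic_tail.
Context {R : realType} {d : measure_display} {T : measurableType d}
  {P : probability T R} (X : R -> {RV P >-> R}) (hX : cauchy_process X).

Let r (p : nat) : R := (2 ^ p)%:R^-1.

Let pow2_gt0 (k : nat) : 0 < (2 ^ k)%:R :> R.
Proof. by rewrite ltr0n expn_gt0. Qed.

(** From [l = 2 ^ v] on, the elapsed time is at least [r p] and [hit_prob] is at least
    [2 ^ v / (20 * l)]; the remaining [q] dyadic ranges of the harmonic sum give [q / 2]. *)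
Lemma hit_prob_sum_ge (p q v : nat) (a : R) : `|a| <= 2 -> (q <= p)%N ->
  (((2 ^ v)%:R * q%:R / 40)%:E <=
   \sum_(l < 2 ^ (v + q)) hit_prob X (r (p + v)) a (r p) l)%E.
Proof.
move=> a2 qp.
apply: (@le_trans _ _ (\sum_(2 ^ v <= l < 2 ^ (v + q))
    hit_prob X (r (p + v)) a (r p) l)%E); last first.
  rewrite -(big_mkord xpredT (fun l => hit_prob X (r (p + v)) a (r p) l)).
  rewrite [leRHS](big_cat_nat (n := (2 ^ v)%N)) ?leq_pexp2l ?leq_addr//=.
  by rewrite leeDr// sume_ge0.
apply: (@le_trans _ _ (\sum_(2 ^ v <= l < 2 ^ (v + q))
    ((2 ^ v)%:R / 20 * l%:R^-1)%:E)%E).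
  rewrite sumEFin lee_fin -mulr_sumr.
  have := harmonic_dyadic_ge v q (R := R).
  have := pow2_gt0 v; nra.
rewrite big_nat_cond [leRHS]big_nat_cond; apply: lee_sum => l.
rewrite andbT => /andP[vl lq].
have l0 : (0 < l)%N by rewrite (leq_trans _ vl)// expn_gt0.
have lR : 0 < l%:R :> R by rewrite ltr0n.
apply: le_trans; last apply: hit_prob_ge => //.
- rewrite lee_fin /r expnD natrM le_eqVlt; apply/orP; left; apply/eqP.
  by field; rewrite !gt_eqF.
- by rewrite /r invr_gt0.
- by rewrite /r invr_gt0.
- rewrite /r expnD natrM invfM mulrCA.
  apply: ler_peMr; first by rewrite invr_ge0.
  by rewrite ler_pdivlMr// mul1r ler_nat.
Qed.

(* This is 5 m b for m = 2^(u+1) blocks and b = 960 * 2^(p - 2u), p = 2^u; the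
   latter makes 12 n <= b g hold with the n and g of [walk_cells_tail]. *)
Definition cell_bound (u : nat) : nat := 5 * 2 ^ u.+1 * (960 * 2 ^ (2 ^ u - 2 * u)).

(** An instance of [visited_cells_tail] with [2 * p] blocks of [n = 2 ^ (v + p - u)] steps, which
    together make the [2 ^ (p + v + 1)] sampling times of [[0, 2)]. *)
Lemma walk_cells_tail (u v : nat) (a : R) : (0 < u)%N -> `|a| <= 2 ->
  let p := (2 ^ u)%N in
  exists B : set T, [/\ measurable B, (P B <= (r (8 * p))%:E)%E &
  forall w, (cell_bound u <= size (undup
    [seq cell (r p) (fun t => X t w) a (k%:R * r (p + v)) |
       k <- iota 0 (2 ^ (p + v).+1)]))%N -> B w].
Proof.
move=> u0 a2 p.
have up2 := double_le_expn u u0.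
have up : (u <= p)%N by rewrite (leq_trans _ up2)// leq_pmull.
pose n := (2 ^ (v + (p - u)))%N; pose b := (960 * 2 ^ (p - 2 * u))%N.
pose g : R := (2 ^ v)%:R * (p - u)%:R / 40.
have h0 : 0 < r (p + v) by rewrite invr_gt0.
have r0 : 0 < r p by rewrite invr_gt0.
have b0 : (0 < b)%N by rewrite muln_gt0 expn_gt0.
have pu0 : (0 < p - u)%N by rewrite subn_gt0 ltn_expl.
have g0 : 0 < g by rewrite /g !mulr_gt0// ltr0n.
(* Since [2 * u <= p], also [2 ^ u = p <= 2 * (p - u)]; and [960 / 40 = 24] is the constant in
   [b * g]. *)
have nbg : 12 * n%:R <= b%:R * g.
  have e1 : ((2 * (12 * n) <= 24 * 2 ^ v * 2 ^ (p - 2 * u) * (2 * (p - u))))%N.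
    have -> : n = (2 ^ v * 2 ^ (p - 2 * u) * 2 ^ u)%N.
      by rewrite /n -!expnD; congr (2 ^ _)%N; rewrite /p; lia.
    have : (2 ^ u <= 2 * (p - u))%N by rewrite -/p; lia.
    nia.
  rewrite -(ler_nat R) !natrM in e1.
  rewrite /b /g natrM; lra.
have gn : (g%:E <= \sum_(l < n) hit_prob X (r (p + v)) a (r p) l)%E.
  by apply: hit_prob_sum_ge => //; exact: leq_subr.
have [B [mB PB BT]] := visited_cells_tail X hX _ h0 a _ r0 n b g b0 g0 nbg gn (2 ^ u.+1).
exists B; split => //.
  apply: (le_trans PB); rewrite lee_fin /r natrX.
  by rewrite (_ : 4 * 2 ^ u.+1 = 8 * p)%N// expnS mulnA.
move=> w Dw; apply: BT; apply: leq_trans Dw _; apply: eq_leq.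
congr (size (undup _)).
rewrite (_ : (2 ^ u.+1 * n = 2 ^ (p + v).+1)%N)//.
by rewrite /n -expnD; congr (2 ^ _)%N; lia.
Qed.
End dyadic_tail.

(** For each [v], the union over the [2 ^ p + 2] lines has probability at most
    [(2 ^ p + 2) / 2 ^ (8 * p)]. Outside the limit event every line has at most [cell_bound u]
    visited cells at every mesh, and the covering by boxes applies. *)
Lemma area_upper_event {R : realType} {d : measure_display} {T : measurableType d}
    {P : probability T R} (X : R -> {RV P >-> R}) (hX : cauchy_process X) (u : nat) :
  (0 < u)%N -> exists E : set T, [/\ measurable E,
    (P E <= ((2 ^ u)%:R^-1)%:E)%E &
    forall w, ~ E w -> (area (nbhd (Lambda (fun t => X t w)) ((2 ^ (2 ^ u))%:R^-1)) <=
      (2 ^+ 20 / (2 ^ u)%:R)%:E)%E].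
Proof.
move=> u0; pose p := (2 ^ u)%N; pose r : R := (2 ^ p)%:R^-1.
have pow0 k : 0 < (2 ^ k)%:R :> R by rewrite ltr0n expn_gt0.
have p2 : (2 <= p)%N by rewrite /p -{1}(expn1 2) leq_pexp2l.
have r0 : 0 < r by rewrite invr_gt0.
have r1 : r <= 1 by rewrite invf_le1// ler1n expn_gt0.
pose a (l : nat) : R := (l%:R - 1) * r.
have aB l : (l < 2 ^ p + 2)%N -> `|a l| <= 2.
  move=> lp; have : l%:R <= (2 ^ p)%:R + 1 :> R by rewrite natr1 ler_nat; lia.
  move=> lp1; have l0 : 0 <= l%:R :> R by [].
  have rr : r * (2 ^ p)%:R = 1 by rewrite mulVf// gt_eqF.
  rewrite /a ler_norml; apply/andP; split; first by nra.
  apply: (@le_trans _ _ ((2 ^ p)%:R * r)); last by rewrite mulrC rr; lra.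
  by rewrite ler_wpM2r ?(ltW r0)//; lra.
pose cells v l w := [seq cell r (fun t => X t w) (a l) (k%:R * (2 ^ (p + v))%:R^-1) |
       k <- iota 0 (2 ^ (p + v).+1)].
have tailB v l : exists B : set T, (l < 2 ^ p + 2)%N -> [/\ measurable B,
    (P B <= ((2 ^ (8 * p))%:R^-1)%:E)%E &
    forall w, (cell_bound u <= size (undup (cells v l w)))%N -> B w].
  have [lp|lp] := boolP (l < 2 ^ p + 2)%N; last by exists set0.
  have [B BP] := walk_cells_tail X hX u v (a l) u0 (aB l lp).
  by exists B.
pose B v l := projT1 (cid (tailB v l)).
have BP v l : (l < 2 ^ p + 2)%N -> [/\ measurable (B v l),
    (P (B v l) <= ((2 ^ (8 * p))%:R^-1)%:E)%E &
    forall w, (cell_bound u <= size (undup (cells v l w)))%N -> B v l w].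
  exact: projT2 (cid (tailB v l)).
pose E0 v := \bigcup_(l in `I_(2 ^ p + 2)) B v l.
have mE0 v : measurable (E0 v).
  by apply: bigcup_measurable => l /= lp; have [] := BP v l lp.
have PE0 v : (P (E0 v) <= ((2 ^ u)%:R^-1)%:E)%E.
  apply: (@le_trans _ _ (\sum_(l < 2 ^ p + 2) ((2 ^ (8 * p))%:R^-1)%:E)%E).
    rewrite /E0 bigcup_mkord.
    apply: le_trans.
      by apply: measure_big_setU_le => l; have [] := BP v l (ltn_ord l).
    by apply: lee_sum => l _; have [_ +] := BP v l (ltn_ord l).
  rewrite sumEFin sumr_const card_ord lee_fin -[leLHS]mulr_natr.
  rewrite mulrC ler_pdivrMr// mulrC ler_pdivlMr// -natrM ler_nat.
  have -> : (8 * p = p + 7 * p)%N by lia.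
  rewrite expnD; apply: (@leq_trans (2 ^ p * 2 * 2 ^ u)).
    rewrite leq_mul2r; apply/orP; right; rewrite muln2 -addnn leq_add2l.
    by rewrite -{1}(expn1 2) leq_pexp2l// (leq_trans _ p2).
  rewrite -mulnA leq_pmul2l ?expn_gt0// -{1}(expn1 2) -expnD leq_pexp2l//.
  have : (u < p)%N by exact: ltn_expl.
  lia.
(* The events [E0 v] need not be nested, but the sets of visited cells are, so it
   is enough to exclude the paths that lie in [E0 v] for all large v. *)
pose E := \bigcup_V \bigcap_(v in [set v | (V <= v)%N]) E0 v.
exists E; split.
- apply: bigcupT_measurable => V; apply: bigcap_measurable => //.
  by exists V => /=.
- apply: measure_bigcup_nondecreasing_le => V.
  + by apply: bigcap_measurable => //; exists V => /=.
  + by move=> w wV v /= Vv; apply: wV; exact: ltnW.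
  + apply: le_trans (PE0 V); apply: le_measure; rewrite ?inE//.
      by apply: bigcap_measurable => //; exists V => /=.
    by move=> w; apply => /=.
move=> w nE.
have cellsK v l : (l < 2 ^ p + 2)%N -> (size (undup (cells v l w)) <= cell_bound u)%N.
  move=> lp; rewrite leqNgt; apply/negP => vl; apply: nE.
  exists v => // v' /= vv'; exists l => //.
  have [_ _] := BP v' l lp; apply.
  apply: (leq_trans (ltnW vl)); apply: uniq_leq_size; first exact: undup_uniq.
  move=> c; rewrite !mem_undup.
  have /= sub := dyadic_cellsS (fun t => X t w) p.
  elim: v' vv' => [|v' IH].
    by rewrite leqn0 => /eqP ->.
  rewrite leq_eqVlt => /orP[/eqP -> //|vv'] /(IH vv'); exact: sub.
apply: (le_trans (area_nbhd_Lambda_le _ p _ (cell_bound u) cellsK)).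
  exact: levy_cadlag (cauchy_levy hX) w.
have up2 := double_le_expn u u0; rewrite -/p in up2.
(* Here 5 is bounded by [2 ^ 3] and 960 by [2 ^ 10]. *)
have K14 : (cell_bound u * 2 ^ u <= 2 ^ (14 + p))%N.
  have -> : (14 + p = 3 + u.+1 + 10 + (p - 2 * u) + u)%N by lia.
  rewrite /cell_bound -/p !expnD leq_mul2r; apply/orP; right.
  by rewrite mulnA leq_mul// leq_mul// leq_mul.
have K14R : (cell_bound u)%:R * (2 ^ u)%:R <= 2 ^+ 14 * (2 ^ p)%:R :> R.
  by rewrite -natrX -!natrM ler_nat -expnD.
have p2R : (2 ^ p + 2)%:R <= 2 * (2 ^ p)%:R :> R.
  rewrite -natrM ler_nat mul2n -addnn leq_add2l -{1}(expn1 2).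
  by rewrite leq_pexp2l// (leq_trans _ p2).
have AK : (2 ^ p + 2)%:R * ((cell_bound u)%:R * (2 ^ u)%:R) <=
    (2 * (2 ^ p)%:R) * (2 ^+ 14 * (2 ^ p)%:R) :> R.
  by apply: ler_pM => //; rewrite mulr_ge0.
rewrite lee_fin ler_pdivlMr//.
have N0 : (2 ^ p)%:R != 0 :> R by rewrite gt_eqF.
apply: (@le_trans _ _ ((2 * (2 ^ p)%:R) * (2 ^+ 14 * (2 ^ p)%:R) * (24 * r ^+ 2))).
  by rewrite mulrAC -[X in X * _ <= _]mulrA ler_wpM2r.
(* The constants multiply to [2 ^ 14 * 48], and [48 <= 2 ^ 6]. *)
have -> : 2 ^+ 20 = 2 ^+ 14 * (2 ^+ 5 * 2) :> R by rewrite -exprSr -exprD.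
have : 0 <= 2 ^+ 14 :> R by rewrite exprn_ge0.
move: (2 ^+ 14) => z z0.
rewrite [leLHS](_ : _ = z * (24 * 2)); last by rewrite /r; field.
apply: ler_wpM2l => //; rewrite ler_wpM2r//.
by rewrite -natrX ler_nat.
Qed.

(** Borel-Cantelli: the exceptional probabilities at scales [u + 1] are at most [2 ^ -(u + 1)],
    which is summable. The shift skips the scale 0, excluded from [area_upper_event]. *)
Lemma ae_area_upper {R : realType} {d : measure_display} {T : measurableType d}
    {P : probability T R} (X : R -> {RV P >-> R}) (hX : cauchy_process X) :
  \forall w \ae P, exists u0 : nat, forall u, (u0 <= u)%N ->
    (area (nbhd (Lambda (fun t => X t w)) ((2 ^ (2 ^ u))%:R^-1)) <=
      (2 ^+ 20 / (2 ^ u)%:R)%:E)%E.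
Proof.
have ex u := area_upper_event X hX u.+1 isT.
pose E u := projT1 (cid (ex u)).
have EP u := projT2 (cid (ex u)).
have mE u : measurable (E u) by have [] := EP u.
have PE : P (lim_sup_set E) = 0%E.
  apply: lim_sup_set_cvg0 => //.
  apply: (@le_lt_trans _ _ (1%:E : \bar R)); last exact: ltey.
  apply: le_trans (epsilon_trick0 xpredT (@ler01 R)).
  by apply: lee_nneseries => // u _; rewrite mul1r; have [] := EP u.
exists (lim_sup_set E); split => //.
  by apply: bigcapT_measurable => u; exact: bigcup_measurable.
move=> w /= nw u0 _; apply: contrapT => nE; apply: nw.
exists u0.+1 => -[//|u] u0u.
have [_ _] := EP u; apply => Eu; apply: nE.
by exists u => //=; rewrite -ltnS.
Qed.

(** * Both bounds at all small scales, and the union of rotated copies *)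

Lemma area_lower {R : realType} (f : R -> R) (u : nat) : (3 <= u)%N ->
  ((32^-1 / (2 ^ u)%:R)%:E <= area (nbhd (Lambda f) ((2 ^ (2 ^ u))%:R^-1)))%E.
Proof.
move=> u3; set p := (2 ^ u)%N.
have pu : (u + 5 <= p)%N.
  by rewrite /p; elim: u u3 {p} => [//|u IH]; rewrite leq_eqVlt => /orP[/eqP <-//|/IH];
    rewrite expnS; lia.
(* With [M = 2 ^ w], [M * e = 1 / (32 * p)]; as [w + 1 <= p], the overlaps cost at most [e / 4] per
   strip, so at least [e] of the area [2 * e] of each strip remains. *)
pose w := (p - u - 5)%N; pose e : R := (2 ^ p)%:R^-1.
have pow0 k : 0 < (2 ^ k)%:R :> R by rewrite ltr0n expn_gt0.
have e0 : 0 < e by rewrite invr_gt0.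
have H j : (j < 2 ^ w)%N -> \sum_(i < j) i.+1%:R^-1 <= w.+1%:R :> R.
  by move=> /ltnW; exact: harmonic_dyadic_le.
apply: le_trans (area_nbhd_Lambda_ge f e w.+1%:R (2 ^ w) e0 _ H); last first.
  by rewrite expn_gt0.
have Mp : (2 ^ w)%:R * e = 32^-1 / p%:R.
  have pE : (2 ^ p = 2 ^ w * (p * 2 ^ 5))%N.
    by transitivity (2 ^ (w + (u + 5)))%N; [congr (2 ^ _)%N; rewrite /w; lia|
      rewrite !expnD].
  rewrite /e pE !natrM; field.
  by rewrite !gt_eqF ?pow0.
have wp : w.+1%:R <= p%:R :> R by rewrite ler_nat /w; lia.
have p0 : 0 < p%:R :> R by rewrite pow0.
rewrite lee_fin -Mp ler_pM2l// -subr_ge0.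
have -> : 2 * e - 8 * e ^+ 2 * (2 ^ w)%:R * w.+1%:R - e =
    e * (1 - 8 * ((2 ^ w)%:R * e) * w.+1%:R) by ring.
rewrite mulr_ge0 ?(ltW e0)// subr_ge0 Mp.
have -> : 8 * (32^-1 / p%:R) * w.+1%:R = (w.+1%:R / 4) / p%:R :> R.
  by field; rewrite gt_eqF.
rewrite ler_pdivrMr// mul1r.
have : 0 <= w.+1%:R :> R by [].
lra.
Qed.

(** [u + 1] is the least exponent [k] with [2 ^ -(2 ^ k) <= e]; taking logarithms determines
    [|ln e|] up to a factor 2. *)
Lemma dyadic_log_scale {R : realType} (u0 : nat) (e : R) :
  0 < e -> e < (2 ^ (2 ^ u0))%:R^-1 -> exists2 u, (u0 <= u)%N &
   [/\ (2 ^ (2 ^ u.+1))%:R^-1 <= e, e < (2 ^ (2 ^ u))%:R^-1,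
     (2 ^ u)%:R * ln 2 <= `|ln e| & `|ln e| <= (2 ^ u.+1)%:R * ln 2].
Proof.
move=> e0 eu0.
have pow0 k : 0 < (2 ^ k)%:R :> R by rewrite ltr0n expn_gt0.
have ex : exists k, (2 ^ (2 ^ k))%:R^-1 <= e.
  have [k ke] := half_pow_lt e e0; exists k; apply: le_trans (ltW ke).
  by rewrite lef_pV2 ?posrE// ler_nat leq_pexp2l// ltnW// ltn_expl.
have [k ke kmin] := ex_minnP ex.
have u0k : (u0 < k)%N.
  rewrite ltnNge; apply/negP => ku0; move: eu0; apply/negP; rewrite -leNgt.
  apply: le_trans ke; rewrite lef_pV2 ?posrE// ler_nat leq_pexp2l//.
  by rewrite leq_pexp2l.
case: k u0k ke kmin => // u u0u ke kmin; exists u => //.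
have eu : e < (2 ^ (2 ^ u))%:R^-1.
  by rewrite ltNge; apply/negP => /kmin; rewrite ltnn.
have lnE k : ln ((2 ^ (2 ^ k))%:R^-1) = - ((2 ^ k)%:R * ln 2) :> R.
  by rewrite lnV ?posrE// natrX lnXn// mulr_natl.
have l1 : ln e < - ((2 ^ u)%:R * ln 2) by rewrite -lnE ltr_ln ?posrE// invr_gt0.
have l2 : - ((2 ^ u.+1)%:R * ln 2) <= ln e by rewrite -lnE ler_ln ?posrE// invr_gt0.
have ln2 : 0 < ln 2 :> R by rewrite ln_gt0// ltr1n.
have lne : ln e <= 0.
  by apply: ltW; apply: (lt_trans l1); rewrite oppr_lt0 mulr_gt0.
by split => //; rewrite ler0_norm//; lra.
Qed.

(** The neighbourhood of radius [e] lies between those at the scales [u + 1] and [u]. Either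
    comparison loses a factor 2, which turns [1 / 32] into [ln 2 / 64] and [2 ^ 20] into
    [2 ^ 21 * ln 2]. *)
Lemma area_two_sided {R : realType} (f : R -> R) :
  (exists u0 : nat, forall u, (u0 <= u)%N ->
    (area (nbhd (Lambda f) ((2 ^ (2 ^ u))%:R^-1)) <= (2 ^+ 20 / (2 ^ u)%:R)%:E)%E) ->
  \forall e \near (0 : R)^'+,
    ((ln 2 / 64 / `|ln e|)%:E <= area (nbhd (Lambda f) e) /\
     area (nbhd (Lambda f) e) <= (2 ^+ 21 * ln 2 / `|ln e|)%:E)%E.
Proof.
move=> [u0 up].
have pow0 k : 0 < (2 ^ k)%:R :> R by rewrite ltr0n expn_gt0.
have ln2 : 0 < ln 2 :> R by rewrite ln_gt0// ltr1n.
pose u1 := maxn u0 3.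
near=> e.
have e0 : 0 < e by near: e; exact: nbhs_right_gt.
have e1 : e < (2 ^ (2 ^ u1))%:R^-1.
  by near: e; apply: nbhs_right_lt; rewrite invr_gt0.
have [u uu1 [eu1 eu l1 l2]] := dyadic_log_scale u1 e e0 e1.
have [uu0 u3] : (u0 <= u)%N /\ (3 <= u)%N.
  by move: uu1; rewrite geq_max => /andP.
have L0 : 0 < `|ln e| by rewrite (lt_le_trans _ l1)// mulr_gt0.
split.
  apply: (@le_trans _ _ (32^-1 / (2 ^ u.+1)%:R)%:E).
    rewrite lee_fin ler_pdivrMr// mulrAC ler_pdivlMr//.
    rewrite expnS natrM; lra.
  apply: (le_trans (area_lower f u.+1 (leqW u3))).
  by apply: le_area; [exact: measurable_nbhd..|exact: nbhdS].
apply: (@le_trans _ _ (2 ^+ 20 / (2 ^ u)%:R)%:E); last first.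
  rewrite lee_fin ler_pdivlMr// mulrAC ler_pdivrMr// exprSr -!mulrA.
  rewrite ler_wpM2l ?exprn_ge0//.
  by move: l2; rewrite expnS natrM; lra.
apply: le_trans (up u uu0).
by apply: le_area; [exact: measurable_nbhd..|apply: nbhdS => //; exact: ltW].
Unshelve. all: by end_near. Qed.

(** Subadditivity. The copy [k = 0] is treated apart, its sine being zero; for the others the angle
    lies strictly between 0 and [pi]. *)
Lemma area_nbhd_rotations {R : realType} (A : set (R * R)) (e : R) :
  (area (nbhd (\bigcup_(k in `I_4) (rotation (pi * k%:R / 4) @` A)) e) <=
   4%:E * area (nbhd A e))%E.
Proof.
pose B (k : nat) := nbhd (rotation (pi * k%:R / 4) @` A) e.
have AB k : (k < 4)%N -> (area (B k) <= area (nbhd A e))%E.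
  case: k => [_|k k4].
    rewrite /B mulr0 mul0r (_ : rotation 0 @` A = A)//.
    apply/seteqP; split => [_ [[x y] Axy <-]|[x y] Axy].
      by rewrite /rotation cos0 sin0/= !mul0r !mul1r subr0 add0r.
    by exists (x, y) => //; rewrite /rotation cos0 sin0/= !mul0r !mul1r subr0 add0r.
  apply: area_nbhd_rotation; rewrite gt_eqF// sin_gt0_pi//.
  have k3 : k.+1%:R < 4 :> R by rewrite ltr_nat.
  have k1 : 0 < k.+1%:R :> R by [].
  have p0 := @pi_gt0 R.
  by apply/andP; split; [rewrite divr_gt0// mulr_gt0|rewrite ltr_pdivrMr// ltr_pM2l].
apply: (@le_trans _ _ (area (\big[setU/set0]_(k < 4) B k))).
  apply: le_area; [exact: measurable_nbhd| |].
    by apply: bigsetU_measurable => k _; exact: measurable_nbhd.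
  rewrite -bigcup_mkord => _ [a [k k4 ka] [b be <-]].
  by exists k => //; exists a => //; exists b.
apply: le_trans.
  by apply: area_big_setU_le => k; exact: measurable_nbhd.
apply: (@le_trans _ _ (\sum_(k < 4) area (nbhd A e))%E).
  by apply: lee_sum => k _; apply: AB.
rewrite (_ : 4%:E = \sum_(k < 4) 1%:E :> \bar R)%E; last first.
  by rewrite sumEFin sumr_const card_ord.
by rewrite ge0_sume_distrl// lee_sum// => k _; rewrite mul1e.
Qed.

Theorem theorem1p6 (R : realType) (d : measure_display) (T : measurableType d)
    (P : probability T R) (X : R -> {RV P >-> R}) (hX : cauchy_process X) :
  (\forall w \ae P,
     optimal_kakeya
       (\bigcup_(k in `I_4)
          (rotation (pi * k%:R / 4) @` Lambda (fun t => X t w)))) /\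
  (exists c1 c2 : R, [/\ 0 < c1, 0 < c2 &
     \forall w \ae P, \forall e \near (0 : R)^'+,
       ((c1 / `|ln e|)%:E <= area (nbhd (Lambda (fun t => X t w)) e) /\
        area (nbhd (Lambda (fun t => X t w)) e) <= (c2 / `|ln e|)%:E)%E]).
Proof.
have ln2 : 0 < ln 2 :> R by rewrite ln_gt0// ltr1n.
pose C : R := 2 ^+ 21 * ln 2.
have C0 : 0 < C by rewrite mulr_gt0// exprn_gt0.
have two_sided : \forall w \ae P, \forall e \near (0 : R)^'+,
       ((ln 2 / 64 / `|ln e|)%:E <= area (nbhd (Lambda (fun t => X t w)) e) /\
        area (nbhd (Lambda (fun t => X t w)) e) <= (C / `|ln e|)%:E)%E.
  by apply: filterS (ae_area_upper X hX) => w; exact: area_two_sided.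
split; last by exists (ln 2 / 64), C; split => //; rewrite divr_gt0.
apply: filterS two_sided => w bound.
set K := \bigcup_(k in _) _.
(* The four copies multiply the upper constant by 4. This bound also yields the finiteness required
   in [optimal_kakeya]. *)
have Kbound : \forall e \near (0 : R)^'+,
    (area (nbhd K e) <= (4 * C * (1 / `|ln e|))%:E)%E.
  apply: filterS bound => e [_ le]; apply: (le_trans (area_nbhd_rotations _ _)).
  by rewrite mul1r -mulrA EFinM; apply: lee_wpmul2l.
have A0 e : (0 <= area (nbhd K e))%E by exact: measure_ge0.
split; first exact: kakeya_rotations.
  apply: filterS Kbound => e Ke; rewrite ge0_fin_numE//.
  by apply: (le_lt_trans Ke); exact: ltey.
apply/eqO_exP; exists (4 * C); first by rewrite mulr_gt0.
apply: filterS Kbound => e Ke.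
rewrite ger0_norm ?fine_ge0//.
apply: (@le_trans _ _ (4 * C * (1 / `|ln e|))); last first.
  by rewrite ler_wpM2l ?ler_norm// mulr_ge0// ltW.
by rewrite -lee_fin fineK// ge0_fin_numE//; apply: (le_lt_trans Ke); exact: ltey.
Qed.
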